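(* There is an absolute constant $K>0$ such that the following holds. Let $\mu$ be a non-negative locally finite Borel measure on $\mathbb C$ with $\int_{\mathbb C}\min\left(\frac1{|\zeta|},\frac1{|\zeta|^2}\right)d\mu(\zeta)<\infty$, and let $u(z)=\int_{\mathbb C}H(z/\zeta)\,d\mu(\zeta)$ be its canonical integral of genus one. Then for every $r\in(0,\infty)$ $$ M(r,u)\le K\left\{ r\int_0^r\frac{\mathfrak n(t)}{t^2}\,dt+r^2\int_r^\infty\frac{\mathfrak n(t)}{t^3}\,dt+r^2\int_r^\infty\frac{\mathfrak m(t,u)}{t^2}\,dt\right\}, $$ where $\mathfrak n$ is the Levin--Tsuji counting function of $\mu$ and $$ \mathfrak m(r,u)=\frac1{2\pi}\int_0^{2\pi}u^-\big(re^{i\theta}|\sin\theta|\big)\,\frac{d\theta}{\sin^2\theta} $$ is the Tsuji proximity function of $u$.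
   Context: Notation: $H(z)=\log|1-z|+\operatorname{Re}(z)$ for $z\in\mathbb C$ (with $H(1)=-\infty$). The integrability condition on $\mu$ forces $\mu(\{0\})=0$ (with $1/0=+\infty$), and $u$ is a subharmonic function on $\mathbb C$ with values in $[-\infty,\infty)$. $M(r,u)=\max_{|z|\le r}u(z)$. $u^-=\max(0,-u)$. The Levin--Tsuji counting function is $\mathfrak n(r)=\mu\big(\{z:|\operatorname{Im}(1/z)|\ge 1/r\}\big)=\mu(\{|z-ir/2|\le r/2\})+\mu(\{|z+ir/2|\le r/2\})$. The right-hand side is allowed to equal $+\infty$. *)

(* Defs.v *)
From HB Require Import structures.
From mathcomp Require Import all_boot all_order all_algebra.
From mathcomp Require Import all_classical all_reals all_analysis.
From mathcomp Require Import complex.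

Set Implicit Arguments.
Unset Strict Implicit.
Unset Printing Implicit Defensive.

Import Order.TTheory GRing.Theory Num.Theory.
Import numFieldNormedType.Exports.
Import Normc.

Local Open Scope classical_set_scope.
Local Open Scope ring_scope.
Local Open Scope complex_scope.
Local Open Scope ereal_scope.

(* The Borel sigma-algebra of C = R[i]. R[i]^o rather than R[i] because the topology of the modulus is only found by
   canonical-structure inference on the regular-algebra alias. *)
Definition borelC (R : realType) := g_sigma_algebraType (@open R[i]^o).

Section defs.
Context {R : realType}.
Implicit Types (mu : {measure set (borelC R) -> \bar R}) (u : R[i] -> \bar R).

Definition locally_finite mu :=
  forall z : R[i]^o, exists2 U : set R[i]^o, open_nbhs z U & mu U < +oo.

(* Both inverses are taken in \bar R, where 0^-1 = +oo; finiteness of the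
   integral therefore forces mu [set 0] = 0. *)
Definition genus1_integrable mu :=
  \int[mu]_zeta
    mine ((normc (zeta : R[i]))%:E^-1) ((normc (zeta : R[i]) ^+ 2)%:E^-1) < +oo.

(* lne 0 = -oo, hence genus1_kernel 1 = -oo. *)
Definition genus1_kernel (z : R[i]) : \bar R :=
  lne (normc (1 - z)%R)%:E + (complex.Re z)%:E.

(* zeta = 0 yields the junk value genus1_kernel 0 = 0, on a mu-null set. *)
Definition canonical_integral mu (z : R[i]) : \bar R :=
  \int[mu]_zeta genus1_kernel (z / (zeta : R[i]))%R.

(* A supremum, so that the definition is total; it is attained when u is upper
   semicontinuous. *)
Definition max_modulus u (r : R) : \bar R :=
  ereal_sup [set u z | z in [set z : R[i] | (normc z <= r)%R]].

(* As 0^-1 = 0 in R[i], the point 0 is left out; it is mu-null under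
   genus1_integrable. *)
Definition levin_tsuji_counting mu (r : R) : \bar R :=
  mu [set z : R[i] | (r^-1 <= `| complex.Im (z^-1) |)%R].

Definition tsuji_proximity u (r : R) : \bar R :=
  (2 * pi)^-1%:E *
  \int[lebesgue_measure]_(t in `[0%R, (2 * pi)%R])
    (u^\- ((r * `|sin t|)%:C * (cos t +i* sin t))%R * ((sin t ^+ 2)^-1)%:E).

End defs.

(* Main.v *)
From HB Require Import structures.
Require Import Defs.
From mathcomp Require Import all_boot all_order all_algebra.
From mathcomp Require Import all_classical all_reals all_analysis.
From mathcomp Require Import complex.
From mathcomp Require Import measurable_realfun measurable_fun_approximation.
From mathcomp Require Import ring lra.

Import Order.TTheory GRing.Theory Num.Theory.
Import numFieldNormedType.Exports.

Local Open Scope classical_set_scope.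
Local Open Scope ring_scope.

(* Only the case where the integral of m(t,u)/t^2 is finite needs an argument. Near the real axis the
   Tsuji circle of radius t straightens, as t tends to infinity, to the segment [-r, r]; by Fatou's lemma and
   upper semicontinuity, finiteness then forces u >= 0 almost everywhere on [-r, r]. Put w = r / zeta.
   Integrating u(rs) + u(-rs) >= 0 against ds/s^2 on (0, 1] and evaluating the integral of
   log|1 - s^2 w^2| ds/s^2 bounds the mu-integral of log(1 + |w|^2) by that of min(|Im w|, |Im w|^2),
   which by Tonelli is bounded by the two counting terms. Finally, adding to u(z), |z| <= r, a suitable
   multiple of u >= 0 at a point of [-r, r] cancels the linear term of the kernel, so that only
   log(1 + |w|^2) and min(|Im w|, |Im w|^2) remain. *)

(** * Elementary inequalities for the logarithm *)

(** The counting function sees only Im w, so mass near the real axis is invisible to it; the sign of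
    u on that axis is what controls such mass. The weight ds/s^2 suits this because the integral of
    log|1 - s^2 w^2| ds/s^2 over the whole half-line is pi |Im w|, hence 0 for real w. Stopping at s
    = 1 discards the part s > 1, which for real w is comparable to log(1 + w^2): this is the gain.
    The kernel is unbounded below and u may take the value -oo, so limits and interchanges of
    integrals are carried out on the non-negative function 2 min(|w|, |w|^2) - kernel. Against
    ds/s^2 its integral diverges at 0, which forces a truncation at s = 1/Y. The majorant then
    contributes the same finite term to both sides, this term is cancelled, and only afterwards does
    Y tend to infinity. *)

Section real_inequalities.
Context {R : realType}.
Implicit Types (x y s t xi e : R).

Lemma ln_le_subr1 x : 0 < x -> ln x <= x - 1.
Proof. by move=> x0; have := @le_ln1Dx R (x - 1); rewrite (addrC 1) subrK; apply; lra. Qed.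

Lemma mul_ln_ge x : 0 < x -> x - 1 <= x * ln x.
Proof.
move=> x0; have := ln_le_subr1 (x^-1); rewrite invr_gt0 => /(_ x0).
rewrite lnV ?posrE// => h; have := ler_pM2l x0 (- ln x) (x^-1 - 1).
by rewrite h mulrBr mulfV ?gt_eqF// => /esym; lra.
Qed.

Lemma ln_sqr x : 0 < x -> ln (x ^+ 2) = 2 * ln x.
Proof. by move=> x0; rewrite lnXn// mulr_natl. Qed.

Lemma ln_le_mono x y : 0 < x -> x <= y -> ln x <= ln y.
Proof. by move=> x0 xy; rewrite ler_ln ?posrE//; exact: lt_le_trans xy. Qed.

Lemma ln1D_le_sqrt t : 0 <= t -> ln (1 + t ^+ 2) <= 2 * t.
Proof.
move=> t0; apply: (@le_trans _ _ (ln ((1 + t) ^+ 2))).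
  by apply: ln_le_mono; nra.
rewrite ln_sqr; last lra.
by have := ln_le_subr1 (1 + t); lra.
Qed.

Lemma ln1D_ge_half t : 0 <= t <= 1 -> t / 2 <= ln (1 + t).
Proof.
move=> /andP[t0 t1]; have := mul_ln_ge (1 + t); nra.
Qed.

(* [x ln x = 2 x ln (sqrt x) >= 2 (x - sqrt x)] *)
Lemma mul_ln_ge_sqrt x : 0 < x -> 2 * x - 2 * Num.sqrt x <= x * ln x.
Proof.
move=> x0; have s0 : 0 < Num.sqrt x by rewrite sqrtr_gt0.
have sE : Num.sqrt x ^+ 2 = x by rewrite sqr_sqrtr// ltW.
have := mul_ln_ge (Num.sqrt x) s0.
have -> : ln x = 2 * ln (Num.sqrt x) by rewrite -{1}sE ln_sqr.
set q := Num.sqrt x in s0 sE *; set l := ln q => h.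
have := ler_wpM2l (ltW s0) h; rewrite -sE; lra.
Qed.

(** By [mul_ln_ge_sqrt] the right-hand side is at least 4 - 2 (sqrt(1 + xi) + sqrt(1 - xi)). The sum
    of roots is at most 2 - xi^2 / 4, because its square is 2 + 2 sqrt(1 - xi^2) <= 4 - xi^2. *)
Lemma entropy_ge xi : 0 <= xi <= 1 ->
  xi ^+ 2 / 2 <= (1 + xi) * ln (1 + xi) + (1 - xi) * ln (1 - xi).
Proof.
move=> /andP[x0 x1].
have H1 : 2 * (1 + xi) - 2 * Num.sqrt (1 + xi) <= (1 + xi) * ln (1 + xi).
  by apply: mul_ln_ge_sqrt; lra.
have H2 : 2 * (1 - xi) - 2 * Num.sqrt (1 - xi) <= (1 - xi) * ln (1 - xi).
  have [x1'|x1'] := ltP xi 1; first by apply: mul_ln_ge_sqrt; lra.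
  have -> : 1 - xi = 0 by lra.
  by rewrite sqrtr0 !mulr0 mul0r subr0.
apply: le_trans (lerD H1 H2).
have := sqr_sqrtr (_ : 0 <= 1 + xi); have := sqr_sqrtr (_ : 0 <= 1 - xi).
have := sqrtr_ge0 (1 + xi); have := sqrtr_ge0 (1 - xi).
set a := Num.sqrt (1 + xi); set b := Num.sqrt (1 - xi).
move=> b0 a0 /(_ ltac:(lra)) hb /(_ ltac:(lra)) ha.
suff : a + b <= 2 - xi ^+ 2 / 4 by nra.
have abE : (a * b) ^+ 2 = 1 - xi ^+ 2 by rewrite exprMn ha hb; ring.
have ab : a * b <= 1 - xi ^+ 2 / 2.
  rewrite -(@ler_pXn2r _ 2)// ?nnegrE ?mulr_ge0//; last nra.
  by rewrite abE; nra.
have q0 : 0 <= 2 - xi ^+ 2 / 4 by clear -x0 x1; nra.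
rewrite -(@ler_pXn2r _ 2)// ?nnegrE ?addr_ge0//.
have -> : (a + b) ^+ 2 = 2 + 2 * (a * b) by rewrite sqrrD ha hb; ring.
clear -ab; nra.
Qed.

(** The logarithmic part of the primitive [kint_prim] at the upper end s = 1. *)
Definition logB xi e : R :=
  (1 - xi) / 2 * ln ((1 - xi) ^+ 2 + e ^+ 2) +
  (1 + xi) / 2 * ln ((1 + xi) ^+ 2 + e ^+ 2).

Lemma logB_ge_small xi e : 0 <= xi <= 1 -> 0 < e -> xi ^+ 2 / 2 <= logB xi e.
Proof.
move=> /andP[x0 x1] e0; apply: le_trans (entropy_ge xi _) _; first exact/andP.
rewrite addrC /logB; apply: lerD.
  have [x1'|x1'] := ltP xi 1; last first.
    have -> : 1 - xi = 0 by lra.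
    by rewrite !mul0r.
  have -> : (1 - xi) * ln (1 - xi) = (1 - xi) / 2 * (2 * ln (1 - xi)) by field.
  apply: ler_wpM2l; first lra.
  rewrite -ln_sqr; last lra.
  by apply: ln_le_mono; nra.
have -> : (1 + xi) * ln (1 + xi) = (1 + xi) / 2 * (2 * ln (1 + xi)) by field.
apply: ler_wpM2l; first lra.
rewrite -ln_sqr; last lra.
by apply: ln_le_mono; nra.
Qed.

(** The coefficients (1 - xi)/2 and (1 + xi)/2 add up to 1, and the first, which multiplies the
    smaller logarithm, is non-positive; so the larger logarithm is a lower bound. *)
Lemma logB_ge_large xi e : 1 <= xi -> 0 < e -> ln (1 + xi ^+ 2 + e ^+ 2) <= logB xi e.
Proof.
move=> x1 e0; rewrite /logB.
have h : ln ((1 - xi) ^+ 2 + e ^+ 2) <= ln ((1 + xi) ^+ 2 + e ^+ 2).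
  by apply: ln_le_mono; nra.
have h' : ln (1 + xi ^+ 2 + e ^+ 2) <= ln ((1 + xi) ^+ 2 + e ^+ 2).
  by apply: ln_le_mono; nra.
apply: le_trans h' _.
move: h; set a := ln _; set b := ln _ => h.
by have := ler_wpM2l (_ : 0 <= (xi - 1) / 2) h; move=> /(_ ltac:(lra)); lra.
Qed.

(** The logarithmic part of [kint_prim] at the lower end s = 1/Y. *)
Definition logA Y xi e : R :=
  (Y - xi) / 2 * ln ((1 - xi / Y) ^+ 2 + (e / Y) ^+ 2) +
  (Y + xi) / 2 * ln ((1 + xi / Y) ^+ 2 + (e / Y) ^+ 2).

(** Dividing xi and e by Y makes Y a common factor. In the scaled variables, when rho is small, ln p
    <= p - 1 makes the terms linear in x cancel and leaves 2 x^2 + rho^2. When rho is large, each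
    logarithm is at most 2 rho, which suffices as long as both coefficients are non-negative, that
    is for x <= 1. *)
Lemma logA_le Y xi e : 0 < Y -> 0 <= xi -> 0 < e ->
  logA Y xi e <= 4 * Num.min (Num.sqrt (xi ^+ 2 + e ^+ 2)) ((xi ^+ 2 + e ^+ 2) / Y).
Proof.
move=> Y0 x0 e0; rewrite /logA.
set x := xi / Y; set f := e / Y.
have xE : xi = x * Y by rewrite /x divfK// gt_eqF.
have eE : e = f * Y by rewrite /f divfK// gt_eqF.
have {}x0 : 0 <= x by rewrite /x divr_ge0// ltW.
have f0 : 0 < f by rewrite /f divr_gt0.
clearbody x f; subst xi e.
have -> : (x * Y) ^+ 2 + (f * Y) ^+ 2 = Y ^+ 2 * (x ^+ 2 + f ^+ 2) by ring.
rewrite sqrtrM ?sqr_ge0// sqrtr_sqr gtr0_norm//.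
have -> : Y ^+ 2 * (x ^+ 2 + f ^+ 2) / Y = Y * (x ^+ 2 + f ^+ 2) by field; rewrite gt_eqF.
rewrite -minr_pMr; last exact: ltW.
have -> : (Y - x * Y) / 2 * ln ((1 - x) ^+ 2 + f ^+ 2) + (Y + x * Y) / 2 * ln ((1 + x) ^+ 2 + f ^+ 2)
  = Y * ((1 - x) / 2 * ln ((1 - x) ^+ 2 + f ^+ 2) + (1 + x) / 2 * ln ((1 + x) ^+ 2 + f ^+ 2)) by ring.
rewrite mulrCA ler_pM2l//.
set rho := Num.sqrt _.
have rho0 : 0 <= rho by rewrite sqrtr_ge0.
have rhoE : rho ^+ 2 = x ^+ 2 + f ^+ 2 by rewrite sqr_sqrtr//; nra.
have xrho : x <= rho by rewrite -(@ler_pXn2r _ 2)// rhoE; nra.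
have f20 : 0 < f ^+ 2 by rewrite exprn_gt0.
have p0 : 0 < (1 - x) ^+ 2 + f ^+ 2 by rewrite ltr_wpDl ?sqr_ge0.
have q0 : 0 < (1 + x) ^+ 2 + f ^+ 2 by rewrite ltr_wpDl ?sqr_ge0.
have lp := ln_le_subr1 _ p0; have lq := ln_le_subr1 _ q0.
have lp' : ln ((1 - x) ^+ 2 + f ^+ 2) <= 2 * rho.
  apply: (@le_trans _ _ (ln ((1 + rho) ^+ 2))); first by apply: ln_le_mono => //; nra.
  by rewrite ln_sqr; [have := ln_le_subr1 (1 + rho); lra|lra].
have lq' : ln ((1 + x) ^+ 2 + f ^+ 2) <= 2 * rho.
  apply: (@le_trans _ _ (ln ((1 + rho) ^+ 2))); first by apply: ln_le_mono => //; nra.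
  by rewrite ln_sqr; [have := ln_le_subr1 (1 + rho); lra|lra].
rewrite -rhoE minEle.
have [r1|r1] := leP rho (rho ^+ 2); last first.
  have rr : rho <= 1 by nra.
  have x1 : x <= 1 by exact: le_trans rr.
  have := ler_wpM2l (_ : 0 <= (1 - x) / 2) lp; move=> /(_ ltac:(lra)).
  have := ler_wpM2l (_ : 0 <= (1 + x) / 2) lq; move=> /(_ ltac:(lra)).
  move: (ln _) (ln _) => a b h1 h2; rewrite rhoE.
  have := sqr_ge0 x; have := ltW f20; move: h1 h2; clear; lra.
have [x1|x1] := leP x 1.
  have := ler_wpM2l (_ : 0 <= (1 - x) / 2) lp'; move=> /(_ ltac:(lra)).
  have := ler_wpM2l (_ : 0 <= (1 + x) / 2) lq'; move=> /(_ ltac:(lra)).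
  move: (ln _) (ln _) => a b h1 h2.
  by lra.
(* For x > 1 the sum is written b + (x - 1)/2 (b - a), with a and b the two logarithms. The quotient
   of their arguments is at most 1 + t^2 with t = 2 sqrt x / (x - 1), so the factor x - 1 disappears
   from the bound. *)
have lqp : ln ((1 + x) ^+ 2 + f ^+ 2) - ln ((1 - x) ^+ 2 + f ^+ 2) <=
    4 * Num.sqrt x / (x - 1).
  rewrite -ln_div ?posrE//.
  set t := 2 * Num.sqrt x / (x - 1).
  have t0 : 0 <= t by rewrite /t divr_ge0 ?mulr_ge0 ?sqrtr_ge0//; lra.
  have tE : t ^+ 2 = 4 * x / (x - 1) ^+ 2.
    by rewrite /t expr_div_n exprMn sqr_sqrtr//; congr (_ / _); ring.
  have -> : 4 * Num.sqrt x / (x - 1) = 2 * t by rewrite /t; ring.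
  apply: le_trans (ln1D_le_sqrt _ t0).
  apply: ln_le_mono; first exact: divr_gt0.
  rewrite ler_pdivrMr// tE mulrDl mul1r.
  have -> : (1 + x) ^+ 2 + f ^+ 2 = (1 - x) ^+ 2 + f ^+ 2 + 4 * x by ring.
  have x10 : 0 < (x - 1) ^+ 2 by rewrite exprn_gt0//; lra.
  rewrite lerD2l -[X in X <= _](divfK (_ : (x - 1) ^+ 2 != 0)) ?gt_eqF//.
  apply: ler_wpM2l; first by rewrite divr_ge0 ?(ltW x10)//; lra.
  by rewrite -opprB sqrrN lerDl ltW.
have sx : Num.sqrt x <= x.
  rewrite -(@ler_pXn2r _ 2)// ?nnegrE ?sqrtr_ge0// sqr_sqrtr//; nra.
have := ler_wpM2l (_ : 0 <= (x - 1) / 2) lqp; move=> /(_ ltac:(lra)).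
have -> : (x - 1) / 2 * (4 * Num.sqrt x / (x - 1)) = 2 * Num.sqrt x by field; lra.
move: lp' lq'; move: (ln _) (ln _) => a b h1 h2 h3.
by lra.
Qed.

End real_inequalities.

(** * The integral of the symmetrised kernel *)

Section calculus.
Context {R : realType}.
Local Notation mu := (@lebesgue_measure R).

Lemma is_derive_within_continuous (f df : R -> R) (a b : R) :
  (forall x, a <= x <= b -> is_derive x 1 f (df x)) ->
  {within `[a, b], continuous f}.
Proof.
move=> fd; apply: derivable_within_continuous => x; rewrite in_itv/= => /fd h.
exact: ex_derive.
Qed.

Lemma FTC2_is_derive (f df F : R -> R) (a b : R) : a < b ->
  (forall x, a <= x <= b -> is_derive x 1 f (df x)) ->
  (forall x, a <= x <= b -> is_derive x 1 F (f x)) ->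
  (\int[mu]_(x in `[a, b]) (f x)%:E = (F b - F a)%:E)%E.
Proof.
move=> ab fd Fd; rewrite EFinB; apply: continuous_FTC2 => //.
- exact: is_derive_within_continuous fd.
- have cF x : a <= x <= b -> {for x, continuous F}.
    by move=> /Fd h; apply/differentiable_continuous/derivable1_diffP/ex_derive.
  split.
  + move=> x; rewrite in_itv/= => /andP[ax xb].
    have h := Fd x; apply: ex_derive; apply: h; rewrite !ltW//.
  + by apply: cvg_at_right_filter; apply: cF; rewrite lexx ltW.
  + by apply: cvg_at_left_filter; apply: cF; rewrite lexx ltW.
- move=> x; rewrite in_itv/= => /andP[ax xb].
  have h : is_derive x 1 F (f x) by apply: Fd; rewrite !ltW.
  by rewrite derive1E; apply: derive_val.
Qed.

Lemma is_derive_conv (f g : R -> R) (x d d' : R) :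
  is_derive x 1 g d -> f =1 g -> d = d' -> is_derive x 1 f d'.
Proof. by move=> gd /funext -> <-. Qed.

Lemma is_derive_inv (x : R) : x != 0 -> is_derive x 1 (fun y : R => y^-1) (- x ^- 2).
Proof.
move=> x0; have := @is_deriveV R id x 1 1 x0 (is_derive_id _ _).
by rewrite /= [_ *: _]mulr1.
Qed.

(** The function atan x + 1/x is non-increasing on x > 0, since 1/(1 + x^2) <= 1/x^2. *)
Lemma atan_diff_le (a b : R) : 0 < a -> a <= b -> atan b - atan a <= a^-1.
Proof.
move=> a0 ab.
pose g (x : R) := atan x + x^-1.
have g' (x : R) : 0 < x -> is_derive x 1 g ((1 + x ^+ 2)^-1 - x ^- 2).
  move=> x0; have x0' : x != 0 by rewrite gt_eqF.
  have := is_derive_inv _ x0'; have := is_derive1_atan x => h1 h2.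
  exact: (is_deriveD h1 h2).
have : g b <= g a.
  apply: (@ler0_derive1_nincr _ g a b) => //.
  - move=> x; rewrite in_itv/= => /andP[ax _].
    by have h := g' x (lt_trans a0 ax); exact: ex_derive.
  - move=> x; rewrite in_itv/= => /andP[ax _].
    have x0 := lt_trans a0 ax.
    have h := g' x x0; rewrite derive1E derive_val subr_le0.
    by rewrite lef_pV2 ?posrE ?lerDr ?addr_gt0 ?exprn_gt0.
  - apply: is_derive_within_continuous => x /andP[ax _].
    by apply: g'; exact: lt_le_trans ax.
have : 0 < b^-1 by rewrite invr_gt0; exact: lt_le_trans ab.
by rewrite /g; lra.
Qed.

Lemma is_derive_ln_comp (p : R -> R) (s dp : R) : 0 < p s ->
  is_derive s 1 p dp -> is_derive s 1 (fun x => ln (p x)) (dp / p s).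
Proof.
move=> p0 pd; have := is_derive1_comp (is_derive1_ln p0) pd.
by rewrite mulrC.
Qed.

Lemma is_derive_atan_comp (p : R -> R) (s dp : R) :
  is_derive s 1 p dp -> is_derive s 1 (fun x => atan (p x)) (dp / (1 + p s ^+ 2)).
Proof.
move=> pd; have := is_derive1_comp (is_derive1_atan (p s)) pd.
by rewrite mulrC.
Qed.

Lemma is_derive_quad (xi e s : R) :
  is_derive s 1 (fun x : R => (1 - x * xi) ^+ 2 + (x * e) ^+ 2)
    (- 2 * xi * (1 - s * xi) + 2 * s * e ^+ 2).
Proof.
have -> : (fun x : R => (1 - x * xi) ^+ 2 + (x * e) ^+ 2) =
  (fun x : R => 1 - (2 * xi) *: x + (xi ^+ 2 + e ^+ 2) *: (x ^+ 2)).
  by apply/funext => x; rewrite /GRing.scale/=; ring.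
apply: is_derive_eq; rewrite /GRing.scale/=; ring.
Qed.

(** A primitive in s of -log|1 - s^2 w^2| / s^2 for w = xi + i e, obtained by integrating by parts
    in the variable 1/s. *)
Definition kint_prim (xi e s : R) : R :=
  (s^-1 - xi) / 2 * ln ((1 - s * xi) ^+ 2 + (s * e) ^+ 2) +
  (s^-1 + xi) / 2 * ln ((1 + s * xi) ^+ 2 + (s * e) ^+ 2) +
  e * (atan ((s^-1 - xi) / e) + atan ((s^-1 + xi) / e)).

Lemma quad_gt0 (xi e s : R) : 0 < s -> 0 < e ->
  0 < (1 - s * xi) ^+ 2 + (s * e) ^+ 2.
Proof. by move=> s0 e0; rewrite ltr_wpDl ?sqr_ge0// exprn_gt0 ?mulr_gt0. Qed.

(** The extra term -xi/s is odd in xi and vanishes when the halves for xi and -xi are added. *)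
Lemma is_derive_kint_half (xi e s : R) : 0 < s -> 0 < e ->
  is_derive s 1 (fun s => (s^-1 - xi) / 2 * ln ((1 - s * xi) ^+ 2 + (s * e) ^+ 2)
                          + e * atan ((s^-1 - xi) / e))
   (- (ln ((1 - s * xi) ^+ 2 + (s * e) ^+ 2) / (2 * s ^+ 2)) - xi / s).
Proof.
move=> s0 e0; have p0 := quad_gt0 xi e s s0 e0.
have h1 := is_derive_ln_comp (fun s => (1 - s * xi) ^+ 2 + (s * e) ^+ 2) s _ p0 (is_derive_quad xi e s).
have s0' : s != 0 by rewrite gt_eqF.
have e0' : e != 0 by rewrite gt_eqF.
have hV := is_derive_inv _ s0'.
have hl : is_derive s 1 (fun s : R => 2^-1 *: (s^-1) - cst (xi / 2) s) (2^-1 *: (- s ^- 2) - 0).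
  by apply: is_deriveB.
have hm := is_deriveM hl h1.
have ha : is_derive s 1 (fun s : R => (e^-1) *: s^-1 - cst (xi / e) s) (e^-1 *: (- s ^- 2) - 0).
  by apply: is_deriveB.
have hat := is_deriveZ e (is_derive_atan_comp _ _ _ ha).
have H := is_deriveD hm hat.
apply: (is_derive_conv _ _ _ _ _ H) => [x|].
  rewrite !fctE /GRing.scale/=; congr (_ * _ + _ * atan _); ring.
rewrite /GRing.scale/=.
have -> : 1 + (e^-1 * s^-1 - xi / e) ^+ 2 =
    ((1 - s * xi) ^+ 2 + (s * e) ^+ 2) / (s * e) ^+ 2.
  by field; rewrite s0' e0'.
set L := ln _.
field; rewrite s0' e0' /= ?andbT.
by rewrite gt_eqF.
Qed.

Lemma is_derive_kint_prim (xi e s : R) : 0 < s -> 0 < e ->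
  is_derive s 1 (kint_prim xi e)
   (- ((ln ((1 - s * xi) ^+ 2 + (s * e) ^+ 2) / 2 +
        ln ((1 + s * xi) ^+ 2 + (s * e) ^+ 2) / 2) / s ^+ 2)).
Proof.
move=> s0 e0; have s0' : s != 0 by rewrite gt_eqF.
have H := is_deriveD (is_derive_kint_half xi e s s0 e0) (is_derive_kint_half (- xi) e s s0 e0).
apply: (is_derive_conv _ _ _ _ _ H) => [x|].
  rewrite fctE /kint_prim mulrN !opprK; ring.
rewrite mulrN opprK; set L := ln _; set L' := ln _.
by field.
Qed.

(** The integrand (c - log|1 - s^2 w^2|) / s^2 with w = xi + i e. It is used with c = 4 [weight],
    the sum of the majorants of the kernel at s and at -s. *)
Definition kint (c xi e s : R) : R :=
  (c - (ln ((1 - s * xi) ^+ 2 + (s * e) ^+ 2) / 2 +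
        ln ((1 + s * xi) ^+ 2 + (s * e) ^+ 2) / 2)) / s ^+ 2.

Lemma integral_kint (c xi e d : R) : 0 < d < 1 -> 0 < e ->
  (\int[mu]_(s in `[d, 1%R]) (kint c xi e s)%:E =
   (c * (d^-1 - 1) - (kint_prim xi e d - kint_prim xi e 1))%:E)%E.
Proof.
move=> /andP[d0 d1] e0.
pose F (s : R) : R := - c *: s^-1 + kint_prim xi e s.
have -> : c * (d^-1 - 1) - (kint_prim xi e d - kint_prim xi e 1) = F 1 - F d.
  by rewrite /F /GRing.scale/= invr1; ring.
have derivk (s : R) : 0 < s -> exists df : R, is_derive s 1 (kint c xi e) df.
  move=> s0; have s0' : s != 0 by rewrite gt_eqF.
  have h1 := is_derive_ln_comp (fun s => (1 - s * xi) ^+ 2 + (s * e) ^+ 2) s _ (quad_gt0 _ _ _ s0 e0) (is_derive_quad xi e s).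
  have h2 := is_derive_ln_comp (fun s => (1 - s * (- xi)) ^+ 2 + (s * e) ^+ 2) s _ (quad_gt0 _ _ _ s0 e0) (is_derive_quad (- xi) e s).
  have h3 := is_deriveM (is_derive_inv s s0') (is_derive_inv s s0').
  have h4 := is_deriveM (is_deriveB (is_derive_cst c s 1) (is_deriveZ 2^-1 (is_deriveD h1 h2))) h3.
  eexists; apply: (is_derive_conv _ _ _ _ _ h4) => [x|]; last by [].
  rewrite /kint !fctE/= /GRing.scale/= mulrN opprK -invfM -expr2.
  congr (_ * _); ring.
(* A derivative of the integrand is wanted only for its continuity, so any choice of one will do. *)
pose df (s : R) := if pselect (0 < s) is left h then projT1 (cid (derivk s h)) else 0.
apply: (@FTC2_is_derive _ df) => //.
- move=> x /andP[dx _]; rewrite /df; case: pselect => [h|]; last by rewrite (lt_le_trans d0).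
  exact: projT2 (cid (derivk x h)).
- move=> x /andP[dx _]; have x0 := lt_le_trans d0 dx.
  have x0' : x != 0 by rewrite gt_eqF.
  have H := is_deriveD (is_deriveZ (- c) (is_derive_inv x x0')) (is_derive_kint_prim xi e x x0 e0).
  apply: (is_derive_conv _ _ _ _ _ H) => [//|].
  rewrite /kint /GRing.scale/=; set L := ln _; set L' := ln _.
  by field.
Qed.

(* Uniform control of the truncated potential [int_{1/Y}^1 log|1 - s^2 w^2| ds/s^2]:
   the linear gain in [|w|] cancels on the real axis, leaving a logarithmic loss. *)
Lemma kint_prim_diff_le (Y xi e : R) : 1 <= Y -> 0 < e ->
  kint_prim xi e Y^-1 - kint_prim xi e 1 <=
  201 * Num.min e (e ^+ 2) - ln (1 + xi ^+ 2 + e ^+ 2) / 4 +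
  4 * Num.min (Num.sqrt (xi ^+ 2 + e ^+ 2)) ((xi ^+ 2 + e ^+ 2) / Y).
Proof.
move=> Y1 e0.
have Y0 : 0 < Y by exact: lt_le_trans Y1.
wlog x0 : xi / 0 <= xi => [H|].
  have [x0|x0] := leP 0 xi; first exact: H.
  have kN s : kint_prim (- xi) e s = kint_prim xi e s.
    by rewrite /kint_prim mulrN !opprK; ring.
  have := H (- xi); rewrite !kN sqrrN; apply; lra.
have -> : kint_prim xi e Y^-1 - kint_prim xi e 1 = logA Y xi e - logB xi e +
   e * ((atan ((Y - xi) / e) - atan ((1 - xi) / e)) +
        (atan ((Y + xi) / e) - atan ((1 + xi) / e))).
  rewrite /kint_prim /logA /logB invrK invr1 !mul1r ![Y^-1 * _]mulrC; ring.
have hA := logA_le Y xi e Y0 x0 e0.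
set M := Num.min (Num.sqrt _) _ in hA *.
set D := _ + (_ - _).
(* The last arctangent is non-negative and the other three are at most pi/2 <= 2 in absolute
   value. *)
have D7 : D <= 7.
  rewrite /D.
  have := @atan_ltpi2 R ((Y - xi) / e); have := @atan_ltpi2 R ((Y + xi) / e).
  have := @atan_gtNpi2 R ((1 - xi) / e); have := @atan_gtNpi2 R ((1 + xi) / e).
  have pi4 : (pi : R) <= 4 by have /andP[_] := @pihalf_02 R; lra.
  have : 0 <= atan ((1 + xi) / e).
    by rewrite -(@atan0 R); apply: le_atan; rewrite divr_ge0//; lra.
  move: (atan _) (atan _) (atan _) (atan _) => a b c d; clear -pi4; lra.
have mine : Num.min e (e ^+ 2) = e \/ (e < 1 /\ Num.min e (e ^+ 2) = e ^+ 2).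
  rewrite minEle; case: ifPn; first by left.
  by rewrite -ltNge => h; right; split => //; nra.
have e2 : 0 < e ^+ 2 by rewrite exprn_gt0.
have mge0 : 0 <= Num.min e (e ^+ 2) by rewrite le_min !ltW.
have l2min : ln (1 + e ^+ 2) <= 2 * Num.min e (e ^+ 2).
  have h1 := ln_le_subr1 (1 + e ^+ 2) (addr_gt0 ltr01 e2).
  by have h2 := ln1D_le_sqrt e (ltW e0); case: mine => [->|[? ->]]; lra.
set m := Num.min e (e ^+ 2) in mine mge0 l2min *.
have eD : e * D <= 7 * e by rewrite mulrC ler_pM2r.
(* Young's inequality trades the loss 7 e for a constant d, paid by [logB], and a multiple of m. The
   choices are d = 3/8 for xi >= 1, where the logarithm is at least 1/2, and d = 1/16 for 1/2 <= xi
   < 1, where xi^2 >= 1/4. The second gives 49/4 * 16 = 196, the bulk of the constant 201. *)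
have e7 (d : R) : 0 < d <= 1 -> 7 * e <= d + 49 / 4 * m / d.
  move=> /andP[d0 d1]; 
  have -> : d + 49 / 4 * m / d = (d ^+ 2 + 49 / 4 * m) / d by field; rewrite gt_eqF.
  rewrite ler_pdivlMr//; case: mine => [->|[_ ->]]; first by nra.
  by have := sqr_ge0 (7 / 2 * e - d); lra.
have [x1|x1] := leP 1 xi.
  have hB := logB_ge_large xi e x1 e0.
  have l2 : 2^-1 <= ln (1 + xi ^+ 2 + e ^+ 2).
    apply: (@le_trans _ _ (ln (1 + 1))); first by have := @ln1D_ge_half R 1; rewrite ler01 lexx div1r; apply.
    by apply: ln_le_mono; nra.
  move: l2 hB; set L := ln _ => l2 hB.
  have := e7 (3 / 8); clear -hA hB eD l2 mge0; lra.
have lL : ln (1 + xi ^+ 2 + e ^+ 2) <= xi ^+ 2 + 2 * m.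
  apply: (@le_trans _ _ (ln ((1 + xi ^+ 2) * (1 + e ^+ 2)))).
    by apply: ln_le_mono; nra.
  rewrite lnM ?posrE; [|nra|nra].
  by have := ln_le_subr1 (1 + xi ^+ 2); rewrite ltr_wpDr ?sqr_ge0// => /(_ isT); lra.
have hB : xi ^+ 2 / 2 <= logB xi e by apply: logB_ge_small => //; rewrite x0 ltW.
have [x2|x2] := leP (1 / 2) xi.
  have := e7 (1 / 16); have : 1 / 4 <= xi ^+ 2 by nra.
  by lra.
(* For xi < 1/2 no constant can be spent, as [logB] yields only xi^2 / 2. But the arctangents at s =
   1 now have arguments of at least 1/(2 e), so D itself is of order e. *)
have D4 : D <= 4 * e.
  have h1 : atan ((Y - xi) / e) - atan ((1 - xi) / e) <= 2 * e.
    apply: (@le_trans _ _ ((1 - xi) / e)^-1).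
      by apply: atan_diff_le; [rewrite divr_gt0//; lra|rewrite ler_pM2r ?invr_gt0//; lra].
    by rewrite invf_div ler_pdivrMr; nra.
  have h2 : atan ((Y + xi) / e) - atan ((1 + xi) / e) <= 2 * e.
    apply: (@le_trans _ _ ((1 + xi) / e)^-1).
      by apply: atan_diff_le; [rewrite divr_gt0//; lra|rewrite ler_pM2r ?invr_gt0//; lra].
    by rewrite invf_div ler_pdivrMr; nra.
  by rewrite /D; lra.
have eD' : e * D <= 4 * e ^+ 2 by nra.
have : e * D <= 7 * m by case: mine => [->|[_ ->]]; nra.
have : 0 <= xi ^+ 2 by exact: sqr_ge0.
lra.
Qed.

End calculus.

Local Open Scope ereal_scope.

(** * Pointwise estimates of the genus one kernel *)

Section integral_comparison.
Context {d} {T : measurableType d} {R : realType} (mu : {measure set T -> \bar R}).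

(* The integral of a nonnegative function is a supremum over the simple functions below it,
   so monotonicity holds for arbitrary nonnegative functions. *)
Lemma le_integral_pointwise (D : set T) (f g : T -> \bar R) :
  (forall x, D x -> f x <= g x) ->
  \int[mu]_(x in D) f x <= \int[mu]_(x in D) g x.
Proof.
move=> fg.
have ge0_le (h k : T -> \bar R) : (forall x, 0 <= h x) -> (forall x, h x <= k x) ->
    \int[mu]_x h x <= \int[mu]_x k x.
  move=> h0 hk; rewrite !ge0_integralTE//; last by move=> x; exact: le_trans (hk x).
  apply: ereal_sup_le => _ [s /= sh <-]; exists s => // x.
  exact: le_trans (sh x) (hk x).
rewrite [leLHS]integral_mkcond [leRHS]integral_mkcond.
have {}fg x : (f \_ D) x <= (g \_ D) x.
  by rewrite !patchE; case: ifPn => // /set_mem; exact: fg.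
rewrite [leLHS]integralE [leRHS]integralE leeB//.
- by apply: ge0_le => x; [exact: funepos_ge0|rewrite !funeposE ge_max !le_max fg lexx orbT].
- apply: ge0_le => x; first exact: funeneg_ge0.
  by rewrite !funenegE ge_max !le_max leeN2 fg lexx orbT.
Qed.

(** The negative part of [f] may have infinite integral. The identity (g - f) + f^+ = g + f^-
    involves only non-negative functions, so it can be integrated term by term; the integral of f^+
    is at most that of [g], hence finite, and can be subtracted. *)
Lemma ge0_integralB_fin (f : T -> \bar R) (g : T -> R) :
  measurable_fun setT f -> measurable_fun setT g -> (forall x, 0 <= g x)%R ->
  (forall x, f x <= (g x)%:E) -> \int[mu]_x (g x)%:E < +oo ->
  \int[mu]_x ((g x)%:E - f x) = \int[mu]_x (g x)%:E - \int[mu]_x f x.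
Proof.
move=> mf mg g0 fg gfin.
have mgE : measurable_fun setT (fun x => (g x)%:E) by exact/measurable_EFinP.
have fin_p x : f^\+ x \is a fin_num.
  rewrite ge0_fin_numE ?funepos_ge0// funeposE gt_max ltry andbT.
  exact: le_lt_trans (fg x) (ltry _).
have Ip : \int[mu]_x f^\+ x <= \int[mu]_x (g x)%:E.
  by apply: le_integral_pointwise => x _; rewrite funeposE ge_max fg lee_fin g0.
have Ipfin : \int[mu]_x f^\+ x \is a fin_num.
  rewrite ge0_fin_numE; first exact: le_lt_trans gfin.
  by apply: integral_ge0 => x _; exact: funepos_ge0.
have gfin' : \int[mu]_x (g x)%:E \is a fin_num.
  by rewrite ge0_fin_numE//; apply: integral_ge0 => x _; rewrite lee_fin.
have gf0 x : 0 <= (g x)%:E - f x by rewrite sube_ge0 ?fg// orbT.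
have mgf : measurable_fun setT (fun x => (g x)%:E - f x) by exact: emeasurable_funB.
have key : \int[mu]_x ((g x)%:E - f x) + \int[mu]_x f^\+ x =
           \int[mu]_x (g x)%:E + \int[mu]_x f^\- x.
  rewrite -!ge0_integralD//.
  - apply: eq_integral => x _; rewrite {1}[f]funeposneg.
    have := fin_p x; rewrite funeposE funenegE.
    case: (f x) => [r| |]//= _; last by rewrite maxNye maxye add0e adde0.
    have [r0|r0] := leP 0%R r.
      rewrite (max_l (_ : 0 <= r%:E))// (max_r (_ : (- r)%:E <= 0)) ?lee_fin ?oppr_le0//.
      by rewrite -!EFinB -!EFinD; congr EFin; ring.
    rewrite (max_r (_ : r%:E <= 0)) ?lee_fin ?ltW// (max_l (_ : 0 <= (- r)%:E)) ?lee_fin ?oppr_ge0 ?ltW//.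
    by rewrite -!EFinB -!EFinD; congr EFin; ring.
  - by move=> x _; rewrite lee_fin.
  - exact: measurable_funeneg.
  - exact: measurable_funepos.
rewrite (integralE mu setT f).
have -> : \int[mu]_x ((g x)%:E - f x) =
    \int[mu]_x (g x)%:E + \int[mu]_x f^\- x - \int[mu]_x f^\+ x.
  by rewrite -key addeK.
rewrite -(fineK Ipfin) -(fineK gfin').
case: (\int[mu]_x f^\- x) => [q| |]//=.
by congr EFin; ring.
Qed.

End integral_comparison.

(** * The kernel in real coordinates *)

Section kernel_pointwise.
Context {R : realType}.
Implicit Types a b x y s e : R.

(** Throughout, w = x + i y stands for r / zeta and a + i b for z / r, a point of the unit disc. Of
    the three functions of w below, [weight] is the one that the hypothesis on the measure makes
    integrable, and [vweight] the one that the counting function bounds. *)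
Definition rho2 x y : R := (x ^+ 2 + y ^+ 2)%R.

Definition weight x y : R := Num.min (Num.sqrt (rho2 x y)) (rho2 x y).

Definition vweight y : R := Num.min `|y|%R (y ^+ 2)%R.

Definition logweight x y : R := ln (1 + rho2 x y).

Definition dist2 a b x y : R := ((1 - (a * x - b * y)) ^+ 2 + (a * y + b * x) ^+ 2)%R.

(* [H((a + ib)(x + iy))] in real coordinates *)
Definition hker a b x y : \bar R :=
  if (dist2 a b x y == 0)%R then -oo
  else (ln (dist2 a b x y) / 2 + (a * x - b * y))%:E.

Lemma rho2_ge0 x y : (0 <= rho2 x y)%R.
Proof. by rewrite addr_ge0 ?sqr_ge0. Qed.

Lemma weight_ge0 x y : (0 <= weight x y)%R.
Proof. by rewrite le_min sqrtr_ge0 rho2_ge0. Qed.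

Lemma vweight_ge0 y : (0 <= vweight y)%R.
Proof. by rewrite le_min normr_ge0 sqr_ge0. Qed.

Lemma logweight_ge0 x y : (0 <= logweight x y)%R.
Proof. by rewrite ln_ge0// lerDl rho2_ge0. Qed.

Lemma dist2_ge0 a b x y : (0 <= dist2 a b x y)%R.
Proof. by rewrite addr_ge0 ?sqr_ge0. Qed.

Lemma sqr_rho x y : (Num.sqrt (rho2 x y) ^+ 2 = rho2 x y)%R.
Proof. by rewrite sqr_sqrtr// rho2_ge0. Qed.

Lemma abs_le_rho x y : (`|y| <= Num.sqrt (rho2 x y))%R.
Proof. by rewrite -sqrtr_sqr ler_wsqrtr// lerDr sqr_ge0. Qed.

Lemma dot_le a b x y : (a ^+ 2 + b ^+ 2 <= 1)%R ->
  ((a * x - b * y) ^+ 2 + (a * y + b * x) ^+ 2 <= rho2 x y)%R.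
Proof.
move=> ab.
have -> : ((a * x - b * y) ^+ 2 + (a * y + b * x) ^+ 2 =
  (a ^+ 2 + b ^+ 2) * rho2 x y)%R by rewrite /rho2; ring.
by rewrite ler_piMl// rho2_ge0.
Qed.

Lemma dist2_le a b x y : (a ^+ 2 + b ^+ 2 <= 1)%R ->
  (dist2 a b x y <= (1 + Num.sqrt (rho2 x y)) ^+ 2)%R.
Proof.
move=> ab; have := dot_le a b x y ab; have := sqr_rho x y.
have := sqrtr_ge0 (rho2 x y); set r := Num.sqrt _.
rewrite /dist2; set p := (a * x - _)%R; set q := (a * y + _)%R => r0 rE pq.
have : (- r <= p)%R.
  by rewrite lerNl -(ger0_norm r0); apply: real_ler_normlW;
   [exact: num_real|rewrite normrN -ler_sqr ?nnegrE// !real_normK ?num_real//;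
    have := sqr_ge0 q; lra].
lra.
Qed.

(** The first bound uses ln p <= p - 1, whose linear term cancels the real part in the kernel; it is
    good for small w. The second uses |1 - z w| <= 1 + |w| for |z| <= 1; it is good for large w. *)
Lemma hker_real_le a b x y : (a ^+ 2 + b ^+ 2 <= 1)%R -> (dist2 a b x y != 0)%R ->
  (ln (dist2 a b x y) / 2 + (a * x - b * y) <= rho2 x y / 2)%R /\
  (ln (dist2 a b x y) / 2 <= ln (1 + Num.sqrt (rho2 x y)))%R.
Proof.
move=> ab p0.
have {}p0 : (0 < dist2 a b x y)%R by rewrite lt_def p0 dist2_ge0.
have h1 := ln_le_subr1 _ p0.
have h2 := dot_le a b x y ab.
split; first by move: h1 h2; rewrite /dist2; move: (ln _) => L; lra.
have s0 := sqrtr_ge0 (rho2 x y).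
have h3 := ln_le_mono _ _ p0 (dist2_le a b x y ab).
by rewrite ln_sqr in h3; lra.
Qed.

Lemma hker_le a b x y : (a ^+ 2 + b ^+ 2 <= 1)%R -> hker a b x y <= (2 * weight x y)%:E.
Proof.
move=> ab; rewrite /hker; case: ifPn => p0; first exact: leNye.
have [h1 h2] := hker_real_le a b x y ab p0.
have r0 := rho2_ge0 x y; have s0 := sqrtr_ge0 (rho2 x y).
have h3 := ln_le_subr1 (1 + Num.sqrt (rho2 x y)) (ltr_pwDl ltr01 s0).
have h4 : (a * x - b * y <= Num.sqrt (rho2 x y))%R.
  rewrite (le_trans (ler_norm _))// -sqrtr_sqr ler_wsqrtr//.
  by have := dot_le a b x y ab; have := sqr_ge0 (a * y + b * x); lra.
by rewrite lee_fin /weight minEle; case: ifP => _; lra.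
Qed.

Lemma hker_usc a b x y (u v : nat -> R) (M : R) :
  u @ \oo --> a -> v @ \oo --> b -> hker a b x y < M%:E ->
  \forall n \near \oo, hker (u n) (v n) x y < M%:E.
Proof.
move=> ua vb h.
have cl : (u n * x - v n * y)%R @[n --> \oo] --> (a * x - b * y)%R.
  by apply: cvgB; exact: cvgMl.
have cp : dist2 (u n) (v n) x y @[n --> \oo] --> dist2 a b x y.
  rewrite /dist2; apply: cvgD.
    by rewrite !expr2; apply: cvgM; apply: cvgB => //; exact: cvg_cst.
  by rewrite !expr2; apply: cvgM; apply: cvgD; apply: cvgMl.
move: h; rewrite /hker; case: ifPn => [/eqP p0 _|p0 h].
  set c := (a * x - b * y)%R in cl.
  have lc : \forall n \near \oo, (u n * x - v n * y < c + 1)%R.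
    by apply: (cvgr_lt _ cl); rewrite ltrDl.
  (* The threshold brings half the logarithm down to M - c - 1, which compensates a real part below
     c + 1. *)
  have lp : \forall n \near \oo, (dist2 (u n) (v n) x y < expR (2 * (M - c - 1)))%R.
    by apply: (cvgr_lt _ cp); rewrite p0 expR_gt0.
  near=> n; case: ifPn => [_|pn]; first exact: ltNyr.
  have pn0 : (0 < dist2 (u n) (v n) x y)%R by rewrite lt_def pn dist2_ge0.
  have h1 : (ln (dist2 (u n) (v n) x y) <= 2 * (M - c - 1))%R.
    by rewrite -[leRHS]expRK; apply: ln_le_mono => //; apply: ltW; near: n.
  have h2 : (u n * x - v n * y < c + 1)%R by near: n.
  by rewrite lte_fin; lra.
have {}p0 : (0 < dist2 a b x y)%R by rewrite lt_def p0 dist2_ge0.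
have cL : (ln (dist2 (u n) (v n) x y) / 2 + (u n * x - v n * y))%R @[n --> \oo] -->
    (ln (dist2 a b x y) / 2 + (a * x - b * y))%R.
  by apply: cvgD => //; apply: cvgMl; apply: continuous_cvg cp; exact: continuous_ln.
have lM : \forall n \near \oo,
    (ln (dist2 (u n) (v n) x y) / 2 + (u n * x - v n * y) < M)%R.
  by apply: (cvgr_lt _ cL); rewrite -lte_fin.
near=> n; case: ifPn => [_|pn]; first exact: ltNyr.
by rewrite lte_fin; near: n.
Unshelve. all: by end_near. Qed.

(* As [beta * c = - a], the terms linear in [x] cancel. *)
Lemma hker_pair_le a b c beta x y : (a ^+ 2 + b ^+ 2 <= 1)%R -> (c ^+ 2 <= 1)%R ->
  (0 <= beta <= 2)%R -> (beta * c = - a)%R -> (dist2 a b x y != 0)%R ->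
  (dist2 c 0 x y != 0)%R ->
  (ln (dist2 a b x y) / 2 + (a * x - b * y) +
   beta * (ln (dist2 c 0 x y) / 2 + (c * x - 0 * y)) <=
   5 * logweight x y + vweight y)%R.
Proof.
move=> ab c1 /andP[be0 be2] bc p0 q0.
have c1' : (c ^+ 2 + 0 ^+ 2 <= 1)%R by rewrite expr0n/= addr0.
have [h1 h2] := hker_real_le a b x y ab p0.
have [h3 h4] := hker_real_le c 0 x y c1' q0.
have r0 := rho2_ge0 x y; have s0 := sqrtr_ge0 (rho2 x y); have sE := sqr_rho x y.
have v0 := vweight_ge0 y; have l0 := logweight_ge0 x y.
(* For |w| <= 1 the quadratic bounds add up to at most 3/2 |w|^2, while log(1 + |w|^2) >= |w|^2 / 2.
   For |w| > 1 the constant 5 is 1 + 2 + 2: one logarithm for the first kernel, [beta] <= 2 for the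
   second, and two for the term -b y. *)
have [r1|r1] := leP (rho2 x y) 1%R.
  have h5 := ln1D_ge_half (rho2 x y); rewrite r0 r1 in h5; have {}h5 := h5 isT.
  have := ler_wpM2l be0 h3; rewrite -/(logweight x y) in h5; nra.
have h6 : (ln (1 + Num.sqrt (rho2 x y)) <= logweight x y)%R.
  by apply: ln_le_mono; nra.
have h7 : (2^-1 <= logweight x y)%R.
  apply: (@le_trans _ _ (ln (1 + 1)%R)).
    by have := @ln1D_ge_half R 1; rewrite ler01 lexx div1r; apply.
  by apply: ln_le_mono; lra.
have h8 : (- (b * y) <= 2 * logweight x y + vweight y)%R.
  have b1 : (`|b| <= 1)%R.
    by have := sqr_ge0 a; rewrite ler_norml; clear -ab; nra.
  have : (- (b * y) <= `|y|)%R.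
    by rewrite (le_trans (ler_norm _))// normrN normrM ler_piMl.
  rewrite /vweight minEle; case: ifPn => [_|]; first by lra.
  rewrite -ltNge -[in X in (X < _)%R -> _](real_normK (num_real y)) => h.
  have := normr_ge0 y; have := sqr_ge0 y => ? ? ?.
  have : (`|y| <= 1)%R by nra.
  lra.
have h9 := ler_wpM2l be0 (le_trans h4 h6).
have -> : (ln (dist2 a b x y) / 2 + (a * x - b * y) +
   beta * (ln (dist2 c 0 x y) / 2 + (c * x - 0 * y)) =
   ln (dist2 a b x y) / 2 - b * y + beta * (ln (dist2 c 0 x y) / 2) + (a + beta * c) * x)%R
   by ring.
rewrite bc subrr mul0r addr0.
have h10 : (beta * logweight x y <= 2 * logweight x y)%R by rewrite ler_wpM2r.
lra.
Qed.

(** Replacing y by a larger e increases |1 - s w| and |1 + s w|, hence lowers the left-hand side,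
    and it keeps the logarithms finite even when w is real. The linear terms s x and -s x cancel. *)
Lemma hkerD_ge_kint s e x y : (`|y| < e)%R -> (0 < s)%R ->
  (kint (4 * weight x y) x e s)%:E <=
  (((2 * weight x y)%:E - hker s 0 x y) + ((2 * weight x y)%:E - hker (- s) 0 x y)) * (s ^- 2)%:E.
Proof.
move=> ye s0.
have e0 : (0 < e)%R by exact: le_lt_trans ye.
have s20 : (0 < s ^- 2)%R by rewrite invr_gt0 exprn_gt0.
have le_e (t : R) : (dist2 t 0 x y <= (1 - t * x) ^+ 2 + (t * e) ^+ 2)%R.
  have : (y ^+ 2 <= e ^+ 2)%R.
    by rewrite -(real_normK (num_real y)) ler_pXn2r ?nnegrE ?(ltW ye) ?(ltW e0).
  rewrite /dist2 !mul0r subr0 addr0 lerD2l !exprMn => h.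
  by rewrite ler_wpM2l ?sqr_ge0.
have hge (t : R) : (2 * weight x y - ln ((1 - t * x) ^+ 2 + (t * e) ^+ 2) / 2 - t * x)%:E <=
    (2 * weight x y)%:E - hker t 0 x y.
  rewrite /hker; case: ifPn => [_|p0]; first by rewrite addey// leey.
  have {}p0 : (0 < dist2 t 0 x y)%R by rewrite lt_def p0 dist2_ge0.
  have := ln_le_mono _ _ p0 (le_e t); rewrite -EFinB lee_fin; lra.
apply: le_trans (lee_wpmul2r _ (leeD (hge s) (hge (- s)%R))); last by rewrite lee_fin ltW.
rewrite -EFinD -EFinM lee_fin /kint mulNr opprK mulNr sqrrN.
by rewrite ler_pM2r//; lra.
Qed.

End kernel_pointwise.

(** * Potentials *)

Lemma limn_einf_ge {R : realType} (l : \bar R) (v : nat -> \bar R) :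
  (forall c : R, c%:E < l -> \forall n \near \oo, c%:E <= v n) -> l <= limn_einf v.
Proof.
move=> h.
have {}h (c : R) : c%:E < l -> c%:E <= limn_einf v.
  move=> /h [N _ Nv]; rewrite limn_einf_lim (cvg_lim _ (@cvg_einfs_sup _ v))//.
  apply: le_trans (ereal_sup_ubound (_ : range (einfs v) (einfs v N))); last by exists N.
  by apply: le_ereal_inf_tmp => _ [n /= Nn <-]; exact: Nv.
case: l h => [r| |] h; last exact: leNye.
- apply/lee_subgt0Pr => e e0; rewrite -EFinB; apply: h.
  by rewrite lte_fin; lra.
- rewrite leye_eq; apply/eqP/eqyP => r r0; apply: h; exact: ltry.
Qed.

Lemma limn_einf_gt {R : realType} (c : \bar R) (v : nat -> \bar R) :
  c < limn_einf v -> \forall n \near \oo, c <= v n.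
Proof.
rewrite limn_einf_lim (cvg_lim _ (@cvg_einfs_sup _ v))// => /ereal_sup_gt[_ [N _ <-] cN].
exists N => // n /= Nn; apply: le_trans (ltW cN) _.
by apply: ereal_inf_lbound; exists n.
Qed.

Lemma integral_indic_mul d (U : measurableType d) (R : realType)
    (m : {measure set U -> \bar R}) (D : set U) (g : U -> \bar R) :
  \int[m]_(x in D) g x = \int[m]_x (g x * (\1_D x)%:E).
Proof.
rewrite integral_mkcond; apply: eq_integral => x _.
by rewrite patchE indicE; case: (x \in D); rewrite ?mule1 ?mule0.
Qed.

Lemma integral_inv_sqr {R : realType} (k d0 : R) : (0 < d0 < 1)%R ->
  \int[lebesgue_measure]_(s in `[d0, 1%R]) (k * s ^- 2)%:E = (k * (d0^-1 - 1))%:E.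
Proof.
move=> /andP[d0p d1].
pose F (s : R) : R := (- k * s^-1)%R.
pose df (s : R) : R := (k * (2 * (- s ^- 2 * s^-1)))%R.
have s_neq0 (s : R) : (d0 <= s <= 1)%R -> (s != 0)%R.
  by move=> /andP[ds _]; rewrite gt_eqF// (lt_le_trans d0p).
have -> : (k * (d0^-1 - 1) = F 1 - F d0)%R by rewrite /F invr1; ring.
apply: (FTC2_is_derive _ df) => // s /s_neq0 s0.
- have H := is_deriveZ k (is_deriveM (is_derive_inv s s0) (is_derive_inv s s0)).
  apply: (is_derive_conv _ _ _ _ _ H) => [x|].
    by rewrite !fctE/= /GRing.scale/= -invfM -expr2.
  by rewrite /df /GRing.scale/=; ring.
- have H := is_deriveZ (- k)%R (is_derive_inv s s0).
  apply: (is_derive_conv _ _ _ _ _ H) => [x|]; first by [].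
  by rewrite /GRing.scale/=; ring.
Qed.

Section potential.
Context {d} {T : measurableType d} {R : realType}.
Variables (mu : {sigma_finite_measure set T -> \bar R}) (xi eta : T -> R).
Hypotheses (mxi : measurable_fun setT xi) (meta : measurable_fun setT eta).

(** With xi + i eta = r / zeta this is u(r (a + i b)), so that the disc of radius r becomes the unit
    disc. *)
Definition potential (a b : R) : \bar R := \int[mu]_t hker a b (xi t) (eta t).

Let W t := weight (xi t) (eta t).
(** Non-negative on the unit disc by [hker_le]. Fatou's lemma and Tonelli's theorem therefore apply
    to it with no integrability of the kernel from below. *)
Let defect (a b : R) t : \bar R := (2 * W t)%:E - hker a b (xi t) (eta t).

Hypothesis Wfin : \int[mu]_t (W t)%:E < +oo.

Lemma measurable_rho2 : measurable_fun setT (fun t => rho2 (xi t) (eta t)).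
Proof. by apply: measurable_funD; exact: measurable_funX. Qed.

Lemma measurable_weight : measurable_fun setT W.
Proof.
apply: measurable_minr; last exact: measurable_rho2.
apply: measurableT_comp measurable_rho2.
by apply: continuous_measurable_fun; exact: sqrt_continuous.
Qed.

Lemma measurable_logweight : measurable_fun setT (fun t => logweight (xi t) (eta t)).
Proof.
apply: measurableT_comp; first exact: measurable_ln.
by apply: measurable_funD => //; exact: measurable_rho2.
Qed.

Lemma measurable_vweight : measurable_fun setT (fun t => vweight (eta t)).
Proof.
apply: measurable_minr; last exact: measurable_funX.
exact: measurableT_comp.
Qed.

Lemma measurable_hker d' (U : measurableType d') (a b x y : U -> R) :
  measurable_fun setT a -> measurable_fun setT b ->
  measurable_fun setT x -> measurable_fun setT y ->
  measurable_fun setT (fun u => hker (a u) (b u) (x u) (y u)).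
Proof.
move=> ma mb mx my.
have mre : measurable_fun setT (fun u => a u * x u - b u * y u)%R.
  by apply: measurable_funB; exact: measurable_funM.
have mp : measurable_fun setT (fun u => dist2 (a u) (b u) (x u) (y u)).
  apply: measurable_funD; apply: measurable_funX.
    exact: measurable_funB.
  by apply: measurable_funD; exact: measurable_funM.
apply: measurable_fun_ifT => //.
- exact: measurable_fun_eqr.
- apply/measurable_EFinP; apply: measurable_funD => //.
  by apply: measurable_funM => //; apply: measurableT_comp mp; exact: measurable_ln.
Qed.

Lemma W_fin_num : \int[mu]_t (W t)%:E \is a fin_num.
Proof.
by rewrite ge0_fin_numE//; apply: integral_ge0 => t _; rewrite lee_fin weight_ge0.
Qed.

Lemma integral_W (k : R) : (0 <= k)%R ->
  \int[mu]_t (k * W t)%:E = k%:E * \int[mu]_t (W t)%:E.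
Proof.
move=> k0; under eq_integral do rewrite EFinM.
rewrite ge0_integralZl_EFin//.
- by move=> t _; rewrite lee_fin weight_ge0.
- by apply/measurable_EFinP; exact: measurable_weight.
Qed.

Lemma defect_ge0 a b t : (a ^+ 2 + b ^+ 2 <= 1)%R -> 0 <= defect a b t.
Proof. by move=> ab; rewrite sube_ge0 ?hker_le// orbT. Qed.

Lemma integral_defect a b : (a ^+ 2 + b ^+ 2 <= 1)%R ->
  \int[mu]_t defect a b t = 2%:E * \int[mu]_t (W t)%:E - potential a b.
Proof.
move=> ab; rewrite -integral_W// ge0_integralB_fin//.
- exact: measurable_hker.
- by apply: measurable_funM => //; exact: measurable_weight.
- by move=> t; rewrite mulr_ge0 ?weight_ge0.
- by move=> t; exact: hker_le.
- by rewrite integral_W// lte_mul_pinfty.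
Qed.

Lemma measurable_defect_comp d' (U : measurableType d') (a b : U -> R) :
  measurable_fun setT a -> measurable_fun setT b ->
  measurable_fun setT (fun ut : U * T => defect (a ut.1) (b ut.1) ut.2).
Proof.
move=> ma mb; apply: emeasurable_funB.
  apply/measurable_EFinP; apply: measurable_funM => //.
  by apply: measurableT_comp measurable_snd; exact: measurable_weight.
apply: measurable_hker; try exact: measurableT_comp measurable_fst.
- exact: measurableT_comp measurable_snd.
- exact: measurableT_comp measurable_snd.
Qed.

(** The potential is recovered as the finite integral of 2 W minus that of the defect, whose
    measurability is part of Tonelli's theorem. *)
Lemma measurable_potential d' (U : measurableType d') (a b : U -> R) :
  measurable_fun setT a -> measurable_fun setT b ->
  (forall u, a u ^+ 2 + b u ^+ 2 <= 1)%R ->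
  measurable_fun setT (fun u => potential (a u) (b u)).
Proof.
move=> ma mb ab.
have mF := @measurable_fun_fubini_tonelli_F _ _ U T R mu _ (measurable_defect_comp _ _ _ _ ma mb)
   (fun ut => defect_ge0 _ _ ut.2 (ab ut.1)).
rewrite (_ : (fun u => _) = (fun u => 2%:E * \int[mu]_t (W t)%:E - \int[mu]_t defect (a u) (b u) t)).
  by apply: emeasurable_funB.
apply/funext => u; rewrite integral_defect// oppeB ?fin_num_adde_defr ?fin_numM ?W_fin_num//.
by rewrite addeA subee ?add0e// fin_numM// W_fin_num.
Qed.

(** Fatou's lemma applied to the defects: [hker_usc] gives their pointwise lower semicontinuity, and
    the finite integral of 2 W turns lower bounds on defects into upper bounds on potentials. *)
Lemma potential_usc (a b : R) (u v : nat -> R) (c : R) :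
  u @ \oo --> a -> v @ \oo --> b -> (forall n, u n ^+ 2 + v n ^+ 2 <= 1)%R ->
  (a ^+ 2 + b ^+ 2 <= 1)%R -> potential a b < c%:E ->
  \forall n \near \oo, potential (u n) (v n) <= c%:E.
Proof.
move=> ua vb uv1 ab hc.
have F := @fatou _ _ _ mu setT measurableT (fun n => defect (u n) (v n)).
have : \int[mu]_t defect a b t <= limn_einf (fun n => \int[mu]_t defect (u n) (v n) t).
  apply: le_trans (F _ _).
  - apply: le_integral_pointwise => t _; apply: limn_einf_ge => {hc}c.
    rewrite /defect => h.
    have : hker a b (xi t) (eta t) < (2 * W t - c)%:E.
      by move: h; case: (hker _ _ _ _) => [s| |]//=; rewrite ?ltNyr// -?EFinB ?lte_fin; lra.
    move=> /(hker_usc _ _ _ _ _ _ _ ua vb); apply: filterS => n.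
    by case: (hker _ _ _ _) => [s| |]//=; rewrite ?leey// -?EFinB ?lte_fin ?lee_fin; lra.
  - move=> n; apply: emeasurable_funB; last exact: measurable_hker.
    by apply/measurable_EFinP; apply: measurable_funM => //; exact: measurable_weight.
  - by move=> n t _; exact: defect_ge0.
rewrite integral_defect//.
under [X in limn_einf X]eq_fun do rewrite integral_defect//.
rewrite -(fineK W_fin_num) -EFinM.
set w := (2 * _)%R => h.
have : (w - c)%:E < limn_einf (fun n => w%:E - potential (u n) (v n)).
  apply: lt_le_trans h; move: hc.
  by case: (potential a b) => [s| |]//=; rewrite ?ltry// -?EFinB ?lte_fin; lra.
move=> /limn_einf_gt; apply: filterS => n.
by case: (potential _ _) => [s| |]//=; rewrite ?leNye// -?EFinB ?lee_fin; lra.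
Qed.

Local Notation mu1 := (@lebesgue_measure R).

Hypothesis good : {ae mu1, forall s, `]0%R, 1%R]%classic s ->
  0 <= potential s 0 /\ 0 <= potential (- s) 0}.

(** The error caused by starting the s-integral at 1/Y: at most W for Y >= 1, and tending to 0
    pointwise as Y grows. *)
Definition tail (Y : R) t : R :=
  Num.min (Num.sqrt (rho2 (xi t) (eta t))) (rho2 (xi t) (eta t) / Y)%R.

(** The primitive requires e > 0 while eta may vanish, so e is taken slightly above |eta| and the
    excess tends to 0. [X] stands for the s-integral of the two defects, possibly +oo; the term 4 W
    (Y - 1) is the integral of 4 W / s^2 over [1/Y, 1]. *)
Lemma integral_kernel_ge (Y : R) t (X : \bar R) : (1 < Y)%R ->
  (forall e : R, (`|eta t| < e)%R ->
    \int[mu1]_(s in `[(Y^-1)%R, 1%R]) (kint (4 * W t) (xi t) e s)%:E <= X) ->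
  (4 * W t * (Y - 1) + logweight (xi t) (eta t) / 4)%:E <=
    X + (201 * vweight (eta t) + 4 * tail Y t)%:E.
Proof.
move=> Y1 hX; apply/lee_addgt0Pr => del del0.
have Y0 : (0 < Y)%R by exact: lt_trans Y1.
set x := xi t in hX *; set y := eta t in hX *; set h := (`|y|)%R in hX.
have h0 : (0 <= h)%R := normr_ge0 y.
have hE : (h ^+ 2 = y ^+ 2)%R by rewrite real_normK ?num_real.
(* Here 205 = 201 + 4 collects the coefficients of the two minima in [kint_prim_diff_le]. Passing
   from h to h + eps, with eps <= 1, raises each minimum by at most (2 h + 2) eps. *)
pose k : R := (205 * (2 * h + 2))%R.
have k0 : (0 < k)%R by rewrite /k; lra.
pose eps : R := Num.min 1%R (del / k)%R.
have eps0 : (0 < eps)%R by rewrite lt_min ltr01 divr_gt0.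
have eps1 : (eps <= 1)%R by rewrite ge_min lexx.
have epsk : (k * eps <= del)%R.
  by rewrite mulrC -ler_pdivlMr// ge_min lexx orbT.
have he : (h < h + eps)%R by rewrite ltrDl.
have e0 : (0 < h + eps)%R by exact: le_lt_trans he.
have := hX _ he; rewrite integral_kint//; last first.
  by rewrite invr_gt0 Y0 invf_lt1.
have := kint_prim_diff_le Y x (h + eps) (ltW Y1) e0.
rewrite invrK.
set K := (kint_prim _ _ _ - _)%R => hK.
have hsq : ((h + eps) ^+ 2 <= y ^+ 2 + (2 * h + 2) * eps)%R by rewrite -hE; nra.
have b1 : (Num.min (h + eps) ((h + eps) ^+ 2) <= vweight y + (2 * h + 2) * eps)%R.
  rewrite /vweight -/h addr_minl le_min !ge_min; apply/andP; split.
    by apply/orP; left; nra.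
  by rewrite hsq orbT.
have b2 : (Num.min (Num.sqrt (x ^+ 2 + (h + eps) ^+ 2)) ((x ^+ 2 + (h + eps) ^+ 2) / Y)
     <= tail Y t + (2 * h + 2) * eps)%R.
  rewrite /tail -/x -/y addr_minl le_min !ge_min; apply/andP; split.
    apply/orP; left; apply: (@le_trans _ _ (Num.sqrt (rho2 x y) + eps)%R); last by nra.
    have r0 := sqrtr_ge0 (rho2 x y); have rE := sqr_rho x y.
    have hr := abs_le_rho x y; rewrite -/h in hr.
    rewrite -(@ler_pXn2r _ 2)// ?nnegrE ?sqrtr_ge0//; last by rewrite addr_ge0// ltW.
    rewrite sqr_sqrtr ?addr_ge0 ?sqr_ge0//.
    have -> : ((Num.sqrt (rho2 x y) + eps) ^+ 2 = rho2 x y + 2 * Num.sqrt (rho2 x y) * eps + eps ^+ 2)%R.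
      by rewrite -{2}rE; ring.
    move: hr r0; set r := Num.sqrt _ => hr r0.
    rewrite /rho2 -hE; have := ler_wpM2r (ltW eps0) hr; lra.
  apply/orP; right; rewrite ler_pdivrMr// mulrDl divfK ?gt_eqF//.
  rewrite /rho2; have : ((2 * h + 2) * eps <= (2 * h + 2) * eps * Y)%R.
    by rewrite ler_peMr ?(ltW Y1)// mulr_ge0 ?(ltW eps0)//; lra.
  lra.
have b3 : (logweight x y <= ln (1 + x ^+ 2 + (h + eps) ^+ 2))%R.
  by apply: ln_le_mono; rewrite /rho2 -hE; [have := rho2_ge0 x y; rewrite /rho2 -hE; lra|nra].
have hkE : (k * eps = 205 * ((2 * h + 2) * eps))%R by rewrite /k; ring.
case: X hX => [X| |] hX.
- rewrite !lee_fin => hX'.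
  move: hK b1 b2 b3 hX' epsk; rewrite hkE.
  move: (Num.min _ _) (Num.min _ _) (ln _) (vweight y) (tail Y t) (logweight _ _) K ((2 * h + 2) * eps)%R => *.
  lra.
- by move=> _; rewrite leey.
- by [].
Qed.

(** The double integral of the two defects against ds/s^2 over [1/Y, 1] is bounded above through
    [good] and below through [integral_kernel_ge]. Both bounds contain 4 (Y - 1) times the integral
    of W, which is finite and cancels. *)
Lemma log_le_vweight_trunc (Y : R) : (1 < Y)%R ->
  (4^-1)%:E * \int[mu]_t (logweight (xi t) (eta t))%:E <=
  201%:E * \int[mu]_t (vweight (eta t))%:E + 4%:E * \int[mu]_t (tail Y t)%:E.
Proof.
move=> Y1.
have Y0 : (0 < Y)%R by exact: lt_trans Y1.
pose D : set R := `[(Y^-1)%R, 1%R]%classic.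
have mD : measurable D by exact: measurable_itv.
have Yi : (0 < Y^-1 < 1)%R by rewrite invr_gt0 Y0 invf_lt1.
have DP (s : R) : D s -> (0 < s)%R /\ (s <= 1)%R.
  rewrite /D /= in_itv/= => /andP[h1 h2]; split => //.
  by apply: lt_le_trans h1; rewrite invr_gt0.
have D2 (s : R) : D s -> (s ^+ 2 + 0 ^+ 2 <= 1)%R /\ ((- s) ^+ 2 + 0 ^+ 2 <= 1)%R.
  by move=> /DP[s0 s1]; rewrite sqrrN expr0n/= addr0; split; nra.
pose f (s : R) t := (defect s 0 t + defect (- s) 0 t) * (s ^- 2)%:E.
pose F (st : R * T) := f st.1 st.2 * (\1_D st.1)%:E.
have f0 s t : D s -> 0 <= f s t.
  move=> Ds; have [h1 h2] := D2 s Ds; have [h3 h4] := DP s Ds.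
  apply: mule_ge0; first by apply: adde_ge0; exact: defect_ge0.
  by rewrite lee_fin invr_ge0 sqr_ge0.
have F0 st : 0 <= F st.
  rewrite /F indicE; case: (boolP (st.1 \in D)) => [/set_mem Ds|_]; last by rewrite mule0.
  by rewrite mule1; exact: f0.
have minv : measurable_fun setT (fun s : R => s ^- 2)%R.
  rewrite (_ : (fun s => _) = (fun s => (s ^+ 2) `^ (-1)))%R; last first.
    by apply/funext => s; rewrite powR_inv1// sqr_ge0.
  exact: (measurableT_comp (measurable_powR (-1)%R) (measurable_funX 2 (measurable_id (D := setT)))).
have mid : measurable_fun setT (fun s : R => s) by exact: measurable_id.
have mf : measurable_fun setT (fun st : R * T => f st.1 st.2).
  apply: emeasurable_funM; last first.
    by apply/measurable_EFinP; exact: (measurableT_comp minv measurable_fst).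
  apply: emeasurable_funD.
    exact: (measurable_defect_comp _ _ (fun s => s) (fun=> 0%R)).
  have mopp : measurable_fun setT (fun s : R => (- s)%R) by exact: measurableT_comp.
  have H := measurable_defect_comp _ _ _ (fun=> 0%R) mopp (measurable_cst (0%R : R)).
  exact: H.
have mF : measurable_fun setT F.
  apply: emeasurable_funM => //; apply/measurable_EFinP.
  have mind : measurable_fun setT (\1_D : R -> R) by exact: measurable_indic.
  exact: (measurableT_comp mind measurable_fst).
have tonelli := @fubini_tonelli _ _ _ _ _ mu1 mu F mF F0.
set w := fine (\int[mu]_t (W t)%:E).
have wE : \int[mu]_t (W t)%:E = w%:E by rewrite fineK// W_fin_num.
have w0 : (0 <= w)%R.
  by apply: fine_ge0; apply: integral_ge0 => t _; rewrite lee_fin weight_ge0.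
have mdef a : measurable_fun setT (defect a 0).
  apply: emeasurable_funB; last exact: measurable_hker.
  by apply/measurable_EFinP; apply: measurable_funM => //; exact: measurable_weight.
(* For almost every s both potentials are non-negative, so the two defects integrate to at most 4
   w. *)
have lhs : \int[mu1]_s \int[mu]_t F (s, t) <= (4 * w * (Y - 1))%:E.
  rewrite -[X in (_ * (X - 1))%R](invrK Y) -integral_inv_sqr// [leRHS]integral_indic_mul.
  apply: ae_ge0_le_integral => //.
  - by move=> s _; apply: integral_ge0 => t _; exact: F0.
  - exact: (measurable_fun_fubini_tonelli_F F mF F0).
  - move=> s _; rewrite mule_ge0// lee_fin ?indicE ?ler0n//.
    by rewrite mulr_ge0 ?invr_ge0 ?sqr_ge0// mulr_ge0.
  - apply: emeasurable_funM; apply/measurable_EFinP; last exact: measurable_indic.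
    by apply: measurable_funM.
  - have [N [mN N0 Nsub]] := good; exists N; split => // s nQ; apply: Nsub => /= hs.
    apply: nQ => /= _.
    rewrite indicE; case: (boolP (s \in D)) => [/set_mem Ds|sD]; last first.
      rewrite mule0 integral0_eq// => t _.
      by rewrite /F indicE/= (negbTE sD) mule0.
    have [s0 s1] := DP s Ds; have [h1 h2] := D2 s Ds.
    rewrite mule1.
    under eq_integral do rewrite /F/= indicE mem_set// mule1.
    rewrite /f ge0_integralZr//; last 3 first.
    + by apply: emeasurable_funD.
    + by move=> t _; rewrite adde_ge0 ?defect_ge0.
    + by rewrite lee_fin invr_ge0 exprn_ge0// ltW.
    rewrite ge0_integralD//; last 2 first.
    + by move=> t _; exact: defect_ge0.
    + by move=> t _; exact: defect_ge0.
    rewrite !integral_defect// wE.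
    have [g1 g2] : 0 <= potential s 0 /\ 0 <= potential (- s) 0.
      by apply: hs; rewrite in_itv/= s0 s1.
    rewrite EFinM lee_wpmul2r ?lee_fin ?invr_ge0 ?exprn_ge0 ?(ltW s0)//.
    have le2 (p : \bar R) : 0 <= p -> 2%:E * w%:E - p <= (2 * w)%:E.
      by case: p => [p| |]//=; rewrite -EFinM ?leNye// -EFinB !lee_fin; lra.
    apply: le_trans (leeD (le2 _ g1) (le2 _ g2)) _.
    by rewrite -EFinD lee_fin; lra.
have rhs t : (4 * W t * (Y - 1) + logweight (xi t) (eta t) / 4)%:E <=
    \int[mu1]_s F (s, t) + (201 * vweight (eta t) + 4 * tail Y t)%:E.
  apply: integral_kernel_ge => // e he.
  rewrite -integral_indic_mul.
  apply: le_integral_pointwise => s /DP[s0 s1].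
  exact: hkerD_ge_kint.
have mtail : measurable_fun setT (tail Y).
  apply: measurable_minr.
    apply: measurableT_comp measurable_rho2.
    by apply: continuous_measurable_fun; exact: sqrt_continuous.
  by apply: measurable_funM => //; exact: measurable_rho2.
have tail0 t : (0 <= tail Y t)%R.
  by rewrite le_min sqrtr_ge0 divr_ge0 ?rho2_ge0// ltW.
have := @le_integral_pointwise _ _ _ mu setT _ _ (fun t _ => rhs t).
under eq_integral do rewrite EFinD.
rewrite [leLHS]ge0_integralD//; last 4 first.
- by move=> t _; rewrite lee_fin !mulr_ge0 ?weight_ge0//; lra.
- by apply/measurable_EFinP; do 2! apply: measurable_funM => //; exact: measurable_weight.
- by move=> t _; rewrite lee_fin divr_ge0 ?logweight_ge0.
- by apply/measurable_EFinP; apply: measurable_funM => //; exact: measurable_logweight.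
under [X in _ + X <= _]eq_integral do rewrite mulrC EFinM.
rewrite ge0_integralZl_EFin//; last 2 first.
- by move=> t _; rewrite lee_fin logweight_ge0.
- by apply/measurable_EFinP; exact: measurable_logweight.
under [X in X + _ <= _]eq_integral do rewrite mulrAC.
rewrite integral_W ?wE; last by lra.
rewrite [leRHS]ge0_integralD//; last 4 first.
- by move=> t _; apply: integral_ge0 => s _; exact: F0.
- exact: (@measurable_fun_fubini_tonelli_G _ _ _ _ _ mu1 F mF F0).
- by move=> t _; rewrite lee_fin addr_ge0// mulr_ge0 ?vweight_ge0.
- apply/measurable_EFinP; apply: measurable_funD; apply: measurable_funM => //.
  exact: measurable_vweight.
under [X in _ <= _ + X]eq_integral do rewrite EFinD !EFinM.
rewrite [X in _ <= _ + X]ge0_integralD//; last 4 first.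
- by move=> t _; rewrite -EFinM lee_fin mulr_ge0 ?vweight_ge0.
- apply/measurable_EFinP; apply: measurable_funM => //; exact: measurable_vweight.
- by move=> t _; rewrite -EFinM lee_fin mulr_ge0.
- apply/measurable_EFinP; exact: measurable_funM.
have mv : measurable_fun setT (fun t => (vweight (eta t))%:E).
  by apply/measurable_EFinP; exact: measurable_vweight.
have mt : measurable_fun setT (fun t => (tail Y t)%:E) by exact/measurable_EFinP.
have v0 t : [set: T] t -> 0 <= (vweight (eta t))%:E by rewrite lee_fin vweight_ge0.
have t0 t : [set: T] t -> 0 <= (tail Y t)%:E by rewrite lee_fin.
rewrite !ge0_integralZl_EFin//.
rewrite -tonelli => h.
have := le_trans h (leeD2r _ lhs).
by rewrite -EFinM mulrAC leeD2lE.
Qed.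

(** Dominated convergence along Y = n + 2, with majorant W, removes the tail; 804 = 4 * 201. *)
Lemma log_le_vweight :
  \int[mu]_t (logweight (xi t) (eta t))%:E <= 804%:E * \int[mu]_t (vweight (eta t))%:E.
Proof.
have mtail (Y : R) : measurable_fun setT (tail Y).
  apply: measurable_minr.
    apply: measurableT_comp measurable_rho2.
    by apply: continuous_measurable_fun; exact: sqrt_continuous.
  by apply: measurable_funM => //; exact: measurable_rho2.
have mW := measurable_weight.
have tail0 (n : nat) t : (0 <= tail n.+2%:R t)%R.
  by rewrite le_min sqrtr_ge0 divr_ge0 ?rho2_ge0.
have tailW (n : nat) t : (tail n.+2%:R t <= W t)%R.
  rewrite /tail /W /weight le_min !ge_min lexx/= ler_pdivrMr// ler_peMr ?rho2_ge0 ?orbT//.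
  by rewrite ler1n.
have cvg0 : \int[mu]_t (tail n.+2%:R t)%:E @[n --> \oo] --> (0 : \bar R).
  have h1 n : measurable_fun setT (fun t => (tail n.+2%:R t)%:E) by exact/measurable_EFinP.
  have h2 : {ae mu, forall t, setT t -> (tail n.+2%:R t)%:E @[n --> \oo] --> (0 : \bar R)}.
    apply: aeW => t _; apply: cvg_EFin; first by near=> n.
    have c1 : (rho2 (xi t) (eta t) * harmonic n)%R @[n --> \oo] --> (rho2 (xi t) (eta t) * 0)%R.
      by apply: cvgMr; exact: cvg_harmonic.
    rewrite mulr0 in c1.
    apply: (squeeze_cvgr _ (cvg_cst 0%R) c1); near=> n.
    rewrite /= tail0/= /tail ge_min; apply/orP; right.
    by rewrite ler_wpM2l ?rho2_ge0// lef_pV2 ?posrE// ler_nat.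
  have h3 : mu.-integrable setT (fun t => (W t)%:E).
    apply/integrableP; split; first exact/measurable_EFinP.
    by under eq_integral do rewrite abse_EFin ger0_norm ?weight_ge0//.
  have h4 : {ae mu, forall t (n : nat), setT t -> `|(tail n.+2%:R t)%:E| <= (W t)%:E}.
    by apply: aeW => t n _; rewrite abse_EFin lee_fin ger0_norm.
  have [_ _] := dominated_convergence measurableT h1 (measurable_cst _) h2 h3 h4.
  by rewrite integral0.
have main (del : R) : (0 < del)%R ->
   (4^-1)%:E * \int[mu]_t (logweight (xi t) (eta t))%:E <=
   201%:E * \int[mu]_t (vweight (eta t))%:E + del%:E.
  move=> del0.
  have : \forall n \near \oo, \int[mu]_t (tail n.+2%:R t)%:E < (del / 4)%:E.
    apply: (cvg0 [set y | y < (del / 4)%:E]); apply: open_nbhs_nbhs; split.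
      exact: open_ereal_lt_ereal.
    by rewrite /= lte_fin divr_gt0.
  move=> [N _ /(_ N (leqnn N)) hN].
  have Y1 : (1 < N.+2%:R :> R)%R by rewrite ltr1n.
  apply: le_trans (log_le_vweight_trunc _ Y1) _; apply: leeD2l.
  apply: le_trans (lee_wpmul2l _ (ltW hN)) _ => //.
  by rewrite -EFinM lee_fin; lra.
have {}main : (4^-1)%:E * \int[mu]_t (logweight (xi t) (eta t))%:E <=
   201%:E * \int[mu]_t (vweight (eta t))%:E by apply/lee_addgt0Pr.
have h4 : 0 <= 4%:E :> \bar R by rewrite lee_fin.
have := lee_wpmul2l h4 main.
rewrite !muleA -!EFinM divff// mul1e.
by have -> : (4 * 201 = 804 :> R)%R by ring.
Unshelve. all: by end_near. Qed.

(** The multiplier is bt = |a| / s and the auxiliary point c is s or -s, of sign opposite to a; s >=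
    1/2 is what gives bt <= 2. In terms of defects the majorants amount to 2 (1 + bt) W on both
    sides and cancel after integration. *)
Lemma potential_le (a b s : R) : (a ^+ 2 + b ^+ 2 <= 1)%R -> (2^-1 <= s <= 1)%R ->
  0 <= potential s 0 -> 0 <= potential (- s) 0 ->
  potential a b <= 5%:E * \int[mu]_t (logweight (xi t) (eta t))%:E +
                   \int[mu]_t (vweight (eta t))%:E.
Proof.
move=> ab /andP[s0 s1] g1 g2.
have a1 : (`|a| <= 1)%R by have := sqr_ge0 b; rewrite ler_norml; nra.
have [c [bt [bt0 [bt2 [btc [c1 gc]]]]]] : exists c bt : R,
  (0 <= bt)%R /\ (bt <= 2)%R /\ (bt * c = - a)%R /\ (c ^+ 2 <= 1)%R /\ 0 <= potential c 0.
  exists (if (0 <= a)%R then - s else s)%R, (`|a| / s)%R.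
  have sp : (0 < s)%R by lra.
  split; first by rewrite divr_ge0// ltW.
  split; first by rewrite ler_pdivrMr//; lra.
  have [a0|a0] := leP 0%R a.
    by rewrite ger0_norm// mulrN divfK ?gt_eqF// sqrrN; split => //; split => //; nra.
  by rewrite ltr0_norm// divfK ?gt_eqF//; split => //; split => //; nra.
have c1' : (c ^+ 2 + 0 ^+ 2 <= 1)%R by rewrite expr0n/= addr0.
set w := fine (\int[mu]_t (W t)%:E).
have wE : \int[mu]_t (W t)%:E = w%:E by rewrite fineK// W_fin_num.
have pw t : (2 * (1 + bt) * W t)%:E <= defect a b t + bt%:E * defect c 0 t +
    (5%:E * (logweight (xi t) (eta t))%:E + (vweight (eta t))%:E).
  have W0 := weight_ge0 (xi t) (eta t).
  have l0 := logweight_ge0 (xi t) (eta t); have v0 := vweight_ge0 (eta t).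
  have d0 := defect_ge0 c 0 t c1'; have d0' := defect_ge0 a b t ab.
  have bd0 : 0 <= bt%:E * defect c 0 t by rewrite mule_ge0.
  rewrite -!EFinM -!EFinD.
  have [p0|p0] := boolP (dist2 a b (xi t) (eta t) == 0%R).
    have -> : defect a b t = +oo by rewrite /defect /hker p0.
    by rewrite !addye ?leey// gt_eqF// (lt_le_trans ltNy0 bd0).
  (* For bt = 0 the second defect may be +oo and is multiplied by 0. [hker_pair_le] is then used at
     c = 0, where its kernel is finite. *)
  have [b0|b0] := eqVneq bt 0%R.
    have a0 : (0 * 0 = - a)%R by rewrite mulr0 -btc b0 mul0r.
    have q0 : (dist2 0 0 (xi t) (eta t) != 0)%R.
      by rewrite /dist2 !mul0r subrr addr0 subr0 expr1n expr0n/= addr0 oner_eq0.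
    have z1 : (0 ^+ 2 <= 1 :> R)%R by rewrite expr0n.
    have z2 : (0 <= (0 : R) <= 2)%R by rewrite lexx ler0n.
    have := hker_pair_le a b 0%R 0%R (xi t) (eta t) ab z1 z2 a0 p0 q0.
    rewrite !mul0r addr0.
    rewrite b0 mul0e adde0 /defect /hker (negbTE p0) -EFinB -EFinD lee_fin /W.
    by lra.
  have {}b0 : (0 < bt)%R by rewrite lt_def b0.
  have [q0|q0] := boolP (dist2 c 0 (xi t) (eta t) == 0%R).
    have -> : defect c 0 t = +oo by rewrite /defect /hker q0.
    rewrite gt0_muley ?lte_fin//.
    by rewrite addey ?addye ?leey// gt_eqF// (lt_le_trans ltNy0 d0').
  have := hker_pair_le a b c bt (xi t) (eta t) ab c1 _ btc p0 q0.
  rewrite bt0 bt2 => /(_ isT) h.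
  rewrite /defect /hker (negbTE p0) (negbTE q0) -!EFinB -EFinM -!EFinD lee_fin -/(W t).
  by move: h; rewrite /W; lra.
have mdef (a' b' : R) : measurable_fun setT (defect a' b').
  apply: emeasurable_funB; last exact: measurable_hker.
  by apply/measurable_EFinP; apply: measurable_funM => //; exact: measurable_weight.
have := @le_integral_pointwise _ _ _ mu setT _ _ (fun t _ => pw t).
rewrite integral_W ?wE; last by rewrite mulr_ge0// addr_ge0.
have m1 : measurable_fun setT (fun t => (logweight (xi t) (eta t))%:E).
  by apply/measurable_EFinP; exact: measurable_logweight.
have m2 : measurable_fun setT (fun t => (vweight (eta t))%:E).
  by apply/measurable_EFinP; exact: measurable_vweight.
have m3 : measurable_fun setT (fun t => bt%:E * defect c 0 t).
  by apply: emeasurable_funM.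
have m4 : measurable_fun setT (fun t => 5%:E * (logweight (xi t) (eta t))%:E).
  by apply: emeasurable_funM.
have n1 t : 0 <= (logweight (xi t) (eta t))%:E by rewrite lee_fin logweight_ge0.
have n2 t : 0 <= (vweight (eta t))%:E by rewrite lee_fin vweight_ge0.
have n3 t : 0 <= bt%:E * defect c 0 t by rewrite mule_ge0 ?defect_ge0.
have n4 t : 0 <= 5%:E * (logweight (xi t) (eta t))%:E by rewrite mule_ge0.
have n5 t : 0 <= defect a b t by exact: defect_ge0.
have n6 t : 0 <= defect c 0 t by exact: defect_ge0.
rewrite ge0_integralD//; last 4 first.
- by move=> t _; exact: adde_ge0.
- exact: emeasurable_funD.
- by move=> t _; exact: adde_ge0.
- exact: emeasurable_funD.
rewrite ge0_integralD// ge0_integralZl//.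
rewrite [X in (_ <= _ + X -> _)]ge0_integralD// [X in (_ <= _ + (X + _) -> _)]ge0_integralZl//.
rewrite !integral_defect// wE.
set L := \int[mu]_t _; set V := \int[mu]_t _.
have S0 : 0 <= 5%:E * L + V by rewrite adde_ge0 ?mule_ge0 ?integral_ge0.
have le2 : bt%:E * (2%:E * w%:E - potential c 0) <= (bt * (2 * w))%:E.
  rewrite EFinM lee_wpmul2l ?lee_fin//.
  by move: gc; case: (potential c 0) => [p| |]//=; rewrite -EFinM ?leNye// -EFinB !lee_fin; lra.
move=> h; have {h} := le_trans h (leeD2r _ (leeD2l _ le2)).
move: S0; case: (5%:E * L + V) => [S| |]// S0; last by rewrite leey.
case: (potential a b) => [p| |]//=.
- by rewrite -EFinM -EFinB -!EFinD !lee_fin; lra.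
- by rewrite leNye.
Qed.

End potential.

(** * The counting function *)

Section affine.
Context {R : realType}.
Local Notation mu1 := (@lebesgue_measure R).

(** The image of Lebesgue measure under x -> (x - b) / c is c times Lebesgue measure, since the
    latter is determined by its values on half-open intervals. *)
Lemma ge0_integral_affine (b c : R) (h : R -> \bar R) : (0 < c)%R ->
  measurable_fun setT h -> (forall s, 0 <= h s) ->
  \int[mu1]_(x in `]b, (b + c)%R]) h ((x - b) / c)%R =
  c%:E * \int[mu1]_(s in `]0%R, 1%R]) h s.
Proof.
move=> c0 mh h0.
pose phi : measurableTypeR R -> measurableTypeR R := fun s => ((s - b) / c)%R.
have mphi : measurable_fun setT phi.
  by apply: measurable_funM => //; apply: measurable_funB.
pose ci : {nonneg R} := NngNum (ltW c0).
have ci0 : (0 <= c^-1)%R by rewrite invr_ge0 ltW.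
have key A : measurable A -> mu1 A = (c^-1)%:E * pushforward mu1 phi A.
  move=> mA.
  apply: (@lebesgue_measure_unique _ (mscale (NngNum ci0) (pushforward mu1 phi))) => //.
  move=> _ [[x y] _ <-] /=.
  rewrite /mscale/= /pushforward.
  have -> : phi @^-1` `]x, y] = `](b + c * x)%R, (b + c * y)%R]%classic.
    apply/seteqP; split => z; rewrite /= /phi !in_itv/= ltr_pdivlMr// ler_pdivrMr//; lra.
  rewrite !lebesgue_measure_itv/= !lte_fin ltrD2l ltr_pM2l//.
  case: ifP => _; last by rewrite mule0.
  by rewrite -!EFinB -EFinM; congr EFin; field; rewrite gt_eqF.
have -> : `]b, (b + c)%R]%classic = phi @^-1` `]0%R, 1%R]%classic.
  apply/seteqP; split => z; rewrite /= /phi !in_itv/= ltr_pdivlMr// ler_pdivrMr//; lra.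
rewrite -(@ge0_integral_pushforward _ _ _ _ _ phi mphi mu1 `]0%R, 1%R]%classic h)//; last first.
  exact: measurable_funS mh.
rewrite (eq_measure_integral (mscale ci mu1)); last first.
  move=> A mA _; rewrite /= /mscale/= key// muleA -EFinM divff ?gt_eqF// mul1e//.
by rewrite ge0_integral_mscale//; exact: measurable_funTS.
Qed.

End affine.

Section sine.
Context {R : realType}.

Lemma sin_mean_value (x : R) : (0 <= x)%R ->
  exists2 c : R, (0 <= c <= x)%R & sin x = (x * cos c)%R.
Proof.
move=> x0.
have [c] := @MVT_segment R sin cos 0%R x x0 (fun y _ => is_derive_sin y)
  (is_derive_within_continuous sin cos 0 x (fun y _ => is_derive_sin y)).
rewrite in_itv/= sin0 !subr0 => hc ->; exists c => //; exact: mulrC.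
Qed.

Lemma sqr_sin_le (x : R) : (0 <= x)%R -> (sin x ^+ 2 <= x ^+ 2)%R.
Proof.
move=> /sin_mean_value[c _ ->]; by rewrite exprMn ler_piMr ?sqr_ge0.
Qed.

End sine.

(** * The counting terms as integrals over the measure *)

Section counting.
Context {d} {T : measurableType d} {R : realType}.
Variables (mu : {sigma_finite_measure set T -> \bar R}) (eta : T -> R).
Hypothesis meta : measurable_fun setT eta.
Local Notation mu1 := (@lebesgue_measure R).

Lemma integral_ge_cst_itv (D : set R) (f : R -> \bar R) (a b c : R) :
  `[a, b]%classic `<=` D -> (a <= b)%R -> (0 <= c)%R -> (forall t, D t -> 0 <= f t) ->
  (forall t, (a <= t <= b)%R -> c%:E <= f t) ->
  (c * (b - a))%:E <= \int[mu1]_(t in D) f t.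
Proof.
move=> abD ab c0 f0 fc.
have -> : (c * (b - a))%:E = \int[mu1]_t (c%:E * (\1_(`[a, b]%classic) t)%:E).
  rewrite -integral_indic_mul integral_cst//= lebesgue_measure_itv/= lte_fin.
  case: ifPn => [_|]; first by rewrite EFinM EFinB.
  rewrite -leNgt => ba; have -> : a = b by apply/eqP; rewrite eq_le ab ba.
  by rewrite subrr mulr0 mule0.
rewrite [leRHS]integral_indic_mul; apply: le_integral_pointwise => t _.
rewrite !indicE; case: (boolP (t \in `[a, b]%classic)) => [tab|_].
  have tab' := set_mem tab; rewrite (mem_set (abD _ tab')) !mule1; apply: fc.
  by move: tab'; rewrite /= in_itv.
rewrite mule0; case: (boolP (t \in D)) => [/set_mem/f0|_]; first by rewrite mule1.
by rewrite mule0.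
Qed.

(** Tonelli's theorem on the set of pairs (t, x) with rho <= t |eta x|, whose section at t is the
    set being counted. *)
Lemma counting_tonelli (D : set R) (k : R -> R) (rho : R) :
  measurable D -> measurable_fun setT k -> (forall t, 0 <= k t)%R ->
  measurable_fun setT (fun x =>
    \int[mu1]_(t in D) ((\1_[set y : R | rho <= y * `|eta x|]%R t)%:E * (k t)%:E)) /\
  \int[mu1]_(t in D) (mu [set x | rho <= t * `|eta x|]%R * (k t)%:E) =
  \int[mu]_x \int[mu1]_(t in D) ((\1_[set y : R | rho <= y * `|eta x|]%R t)%:E * (k t)%:E).
Proof.
move=> mD mk k0.
pose E : set (R * T) := [set tx | rho <= tx.1 * `|eta tx.2|]%R.
have mE : measurable E.
  rewrite -[E]setTI (_ : E = (fun tx : R * T => (rho <= tx.1 * `|eta tx.2|)%R) @^-1` [set true]).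
    apply: measurable_fun_ler => //; apply: measurable_funM => //.
    by apply: measurableT_comp => //; exact: (measurableT_comp meta measurable_snd).
  by apply/seteqP; split.
pose F (tx : R * T) : \bar R := (\1_E tx)%:E * ((k tx.1)%:E * (\1_D tx.1)%:E).
have F0 tx : 0 <= F tx by rewrite !mule_ge0// lee_fin.
have mF : measurable_fun setT F.
  apply: emeasurable_funM; first by apply/measurable_EFinP; exact: measurable_indic.
  apply: emeasurable_funM; apply/measurable_EFinP.
    exact: (measurableT_comp mk measurable_fst).
  have mind : measurable_fun setT (\1_D : R -> R) by exact: measurable_indic.
  exact: (measurableT_comp mind measurable_fst).
have FE x : \int[mu1]_t F (t, x) =
    \int[mu1]_(t in D) ((\1_[set y : R | rho <= y * `|eta x|]%R t)%:E * (k t)%:E).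
  rewrite [RHS]integral_indic_mul; apply: eq_integral => t _.
  by rewrite /F/= !muleA; congr (_%:E * _ * _).
split.
  rewrite (_ : (fun x => _) = fubini_G mu1 F); last by apply/funext => x; rewrite -FE.
  exact: (@measurable_fun_fubini_tonelli_G _ _ _ _ _ mu1 F mF F0).
have := @fubini_tonelli _ _ _ _ _ mu1 mu F mF F0.
have -> : \int[mu1]_t \int[mu]_x F (t, x) =
    \int[mu1]_(t in D) (mu [set x | rho <= t * `|eta x|]%R * (k t)%:E).
  rewrite [RHS]integral_indic_mul; apply: eq_integral => t _.
  have mEt : measurable [set x | rho <= t * `|eta x|]%R.
    by have := measurable_xsection t mE; congr measurable; apply/seteqP; split => x;
      rewrite /xsection/= ?inE.
  rewrite /F/= ge0_integralZr//.
  - rewrite (eq_integral (EFin \o \1_[set x | rho <= t * `|eta x|]%R)); last first.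
      by move=> x _; rewrite /= !indicE; congr ((_ : bool)%:R%:E); apply/idP/idP; rewrite !inE.
    by rewrite integral_indic// setIT muleA.
  - apply/measurable_EFinP.
    have -> : (fun x => \1_E (t, x)) = \1_[set x | rho <= t * `|eta x|]%R :> (T -> R).
      by apply/funext => x; rewrite !indicE; congr ((_ : bool)%:R); apply/idP/idP; rewrite !inE.
    exact: measurable_indic.
  - by rewrite mule_ge0// lee_fin.
by move=> ->; apply: eq_integral => x _; exact: FE.
Qed.

(** After Tonelli the two sides compare pointwise in x. With h = |eta x|, a single dyadic block of t
    is enough: [r/h, 2r/h] in the first integral for h >= 2 and in the second for 0 < h < 1, and
    [r, 2r] for 1 <= h < 2. The last block contributes 1/8 where up to 2 is required, whence 16. *)
Lemma counting_ge_vweight (r : R) : (0 < r)%R ->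
  \int[mu]_x (vweight (eta x))%:E <=
  16%:E * (r%:E * \int[mu1]_(t in `]0%R, r]) (mu [set x | r <= t * `|eta x|]%R * ((t ^+ 2)^-1)%:E) +
   (r ^+ 2)%:E * \int[mu1]_(t in `[r, +oo[) (mu [set x | r <= t * `|eta x|]%R * ((t ^+ 3)^-1)%:E)).
Proof.
move=> r0.
(* The kernel must be non-negative on all of R, hence |t| in place of t; this changes nothing on the
   two domains. *)
have minv (n : nat) : measurable_fun setT (fun t : R => (`|t| ^+ n)^-1)%R.
  rewrite (_ : (fun t => _) = (fun t => (`|t| ^+ n) `^ (-1)))%R; last first.
    by apply/funext => t; rewrite powR_inv1// exprn_ge0.
  apply: (measurableT_comp (measurable_powR (-1)%R)).
  have mabs : measurable_fun setT (fun t : R => `|t|%R) by exact: measurableT_comp.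
  exact: measurable_funX.
have inv0 (n : nat) (t : R) : (0 <= (`|t| ^+ n)^-1)%R by rewrite invr_ge0 exprn_ge0.
set D1 := `]0%R, r]; set D2 := `[r, +oo[.
have [m1 t1] := counting_tonelli [set` D1] (fun t => (`|t| ^+ 2)^-1)%R r
  (measurable_itv _) (minv 2%N) (inv0 2%N).
have [m2 t2] := counting_tonelli [set` D2] (fun t => (`|t| ^+ 3)^-1)%R r
  (measurable_itv _) (minv 3%N) (inv0 3%N).
have -> : \int[mu1]_(t in [set` D1]) (mu [set x | (r <= t * `|eta x|)%R] * ((t ^+ 2)^-1)%:E) =
    \int[mu1]_(t in [set` D1]) (mu [set x | (r <= t * `|eta x|)%R] * ((`|t| ^+ 2)^-1)%:E).
  by apply: eq_integral => t _; rewrite real_normK ?num_real.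
have -> : \int[mu1]_(t in [set` D2]) (mu [set x | (r <= t * `|eta x|)%R] * ((t ^+ 3)^-1)%:E) =
    \int[mu1]_(t in [set` D2]) (mu [set x | (r <= t * `|eta x|)%R] * ((`|t| ^+ 3)^-1)%:E).
  apply: eq_integral => t; rewrite inE/= in_itv/= andbT => rt.
  by rewrite ger0_norm// (le_trans (ltW r0)).
rewrite t1 t2.
set G1 : T -> \bar R := fun x => \int[mu1]_(t in [set` D1]) _ in m1 *.
set G2 : T -> \bar R := fun x => \int[mu1]_(t in [set` D2]) _ in m2 *.
have G10 x : 0 <= G1 x by apply: integral_ge0 => t _; rewrite mule_ge0// lee_fin.
have G20 x : 0 <= G2 x by apply: integral_ge0 => t _; rewrite mule_ge0// lee_fin.
have r00 : (0 <= r)%R by exact: ltW.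
have -> : r%:E * \int[mu]_x G1 x = \int[mu]_x (r%:E * G1 x) by rewrite ge0_integralZl_EFin.
have -> : (r ^+ 2)%:E * \int[mu]_x G2 x = \int[mu]_x ((r ^+ 2)%:E * G2 x).
  by rewrite ge0_integralZl_EFin ?sqr_ge0.
rewrite -ge0_integralD//; last 4 first.
- by move=> x _; rewrite mule_ge0.
- exact: emeasurable_funM.
- by move=> x _; rewrite mule_ge0// lee_fin sqr_ge0.
- exact: emeasurable_funM.
rewrite -ge0_integralZl_EFin//; last 2 first.
- by move=> x _; rewrite adde_ge0// mule_ge0// lee_fin sqr_ge0.
- by apply: emeasurable_funD; exact: emeasurable_funM.
apply: le_integral_pointwise => x _.
set h := (`|eta x|)%R.
have h0 : (0 <= h)%R by exact: normr_ge0.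
have hE : (eta x ^+ 2 = h ^+ 2)%R by rewrite real_normK ?num_real.
have G1E (a b c : R) : (0 < a)%R -> (a <= b)%R -> (b <= r)%R -> (r <= a * h)%R -> (0 <= c)%R ->
    (c * b ^+ 2 <= 1)%R -> (c * (b - a))%:E <= G1 x.
  move=> a0 ab br ah c0 cb; apply: integral_ge_cst_itv => //.
  - move=> t /=; rewrite !in_itv/= => /andP[ta tb].
    by rewrite (lt_le_trans a0 ta) (le_trans tb br).
  - move=> t /andP[ta tb].
    rewrite indicE mem_set ; last by rewrite /= (le_trans ah)// ler_wpM2r.
    have t0 : (0 < t)%R by exact: lt_le_trans ta.
    rewrite mul1e lee_fin ger0_norm ?(ltW t0)// -[leRHS]mul1r ler_pdivlMr ?exprn_gt0//.
    by apply: le_trans cb; rewrite ler_wpM2l// ler_pXn2r ?nnegrE ?(ltW t0)// (le_trans (ltW t0)).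
have G2E (a b c : R) : (r <= a)%R -> (a <= b)%R -> (r <= a * h)%R -> (0 <= c)%R ->
    (c * b ^+ 3 <= 1)%R -> (c * (b - a))%:E <= G2 x.
  move=> ra ab ah c0 cb; have a0 := lt_le_trans r0 ra; apply: integral_ge_cst_itv => //.
  - by move=> t /=; rewrite !in_itv/= andbT => /andP[ta tb]; exact: le_trans ta.
  - move=> t /andP[ta tb].
    rewrite indicE mem_set ; last by rewrite /= (le_trans ah)// ler_wpM2r.
    have t0 : (0 < t)%R by exact: lt_le_trans ta.
    rewrite mul1e lee_fin ger0_norm ?(ltW t0)// -[leRHS]mul1r ler_pdivlMr ?exprn_gt0//.
    by apply: le_trans cb; rewrite ler_wpM2l// ler_pXn2r ?nnegrE ?(ltW t0)// (le_trans (ltW t0)).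
have fromG1 (v : R) : v%:E <= G1 x ->
    (16 * (r * v))%:E <= 16%:E * (r%:E * G1 x + (r ^+ 2)%:E * G2 x).
  move=> hv; rewrite EFinM lee_wpmul2l// EFinM.
  apply: (le_trans (lee_wpmul2l _ hv)); first by rewrite lee_fin.
  by rewrite leeDl// mule_ge0// lee_fin sqr_ge0.
have fromG2 (v : R) : v%:E <= G2 x ->
    (16 * (r ^+ 2 * v))%:E <= 16%:E * (r%:E * G1 x + (r ^+ 2)%:E * G2 x).
  move=> hv; rewrite EFinM lee_wpmul2l// EFinM.
  apply: (le_trans (lee_wpmul2l _ hv)); first by rewrite lee_fin sqr_ge0.
  by rewrite leeDr// mule_ge0.
have rn : (r != 0)%R by rewrite gt_eqF.
have vh : (vweight (eta x) <= h)%R by rewrite ge_min lexx.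
have vh2 : (vweight (eta x) <= h ^+ 2)%R by rewrite -hE ge_min lexx orbT.
have [h2|h2] := leP 2%R h.
  have hp : (0 < h)%R by lra.
  have hn : (h != 0)%R by rewrite gt_eqF.
  have := G1E (r / h)%R (2 * r / h)%R (h ^+ 2 / (4 * r ^+ 2))%R.
  rewrite divr_gt0// divfK// lexx => /(_ isT)/(_ _ _ isT) H.
  apply: le_trans (fromG1 _ (H _ _ _ _)).
  - rewrite lee_fin; apply: (le_trans vh).
    by have -> : (16 * (r * (h ^+ 2 / (4 * r ^+ 2) * (2 * r / h - r / h))) = 4 * h)%R; [field; rewrite hn rn|lra].
  - by rewrite ler_pM2r ?invr_gt0//; lra.
  - by rewrite ler_pdivrMr//; nra.
  - by rewrite divr_ge0 ?mulr_ge0 ?sqr_ge0.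
  - by have -> : (h ^+ 2 / (4 * r ^+ 2) * (2 * r / h) ^+ 2 = 1)%R by field; rewrite hn rn.
have [h1|h1] := leP 1%R h.
  have := G2E r (2 * r)%R (8 * r ^+ 3)^-1%R; rewrite lexx => /(_ isT) H.
  apply: le_trans (fromG2 _ (H _ _ _ _)).
  - rewrite lee_fin; apply: (le_trans vh).
    by have -> : (16 * (r ^+ 2 * ((8 * r ^+ 3)^-1 * (2 * r - r))) = 2)%R; [field; rewrite rn|lra].
  - by lra.
  - by rewrite ler_peMr.
  - by rewrite invr_ge0 mulr_ge0// exprn_ge0.
  - by have -> : ((8 * r ^+ 3)^-1 * (2 * r) ^+ 3 = 1)%R by field; rewrite rn.
have [hz|hp] := eqVneq h 0%R.
  have -> : vweight (eta x) = 0%R.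
    by apply/eqP; rewrite eq_le vweight_ge0 andbT (le_trans vh)// hz.
  by rewrite mule_ge0// adde_ge0// mule_ge0// lee_fin sqr_ge0.
have hpos : (0 < h)%R by rewrite lt_def hp h0.
have := G2E (r / h)%R (2 * r / h)%R (h ^+ 3 / (8 * r ^+ 3))%R.
rewrite divfK// lexx => /(_ _ _ isT) H.
apply: le_trans (fromG2 _ (H _ _ _ _)).
- rewrite lee_fin; apply: (le_trans vh2).
  have -> : (16 * (r ^+ 2 * (h ^+ 3 / (8 * r ^+ 3) * (2 * r / h - r / h))) = 2 * h ^+ 2)%R; first by field; rewrite hp rn.
  by have := sqr_ge0 h; lra.
- by rewrite ler_pdivlMr//; nra.
- by rewrite ler_pM2r ?invr_gt0//; lra.
- by rewrite divr_ge0 ?mulr_ge0 ?exprn_ge0.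
- by have -> : (h ^+ 3 / (8 * r ^+ 3) * (2 * r / h) ^+ 3 = 1)%R by field; rewrite hp rn.
Qed.

End counting.

(** * Boundary values on the real axis *)

Section boundary_values.
Context {d} {T : measurableType d} {R : realType}.
Variables (mu : {sigma_finite_measure set T -> \bar R}) (xi eta : T -> R).
Hypotheses (mxi : measurable_fun setT xi) (meta : measurable_fun setT eta).
Hypothesis Wfin : \int[mu]_t (weight (xi t) (eta t))%:E < +oo.
Local Notation mu1 := (@lebesgue_measure R).
Local Notation pot := (potential mu xi eta).

Let D : set R := `]0%R, 1%R]%classic.

(* The Tsuji circles of radius [tau] in the parameter [s = tau * theta]; the arcs
   [0 < s <= 1] straighten to real segments as [tau] tends to infinity. *)
Definition arc_re (sg tau s : R) : R :=
  (sg * (tau * sin (s / tau)) * cos (s / tau) * \1_(`]0%R, 1%R]%classic : set R) s)%R.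
Definition arc_im (sg tau s : R) : R :=
  (sg * (tau * sin (s / tau)) * sin (s / tau) * \1_(`]0%R, 1%R]%classic : set R) s)%R.
Definition arc_neg (sg tau s : R) : \bar R :=
  maxe (- pot (arc_re sg tau s) (arc_im sg tau s)) 0.

(** Outside (0, 1] the indicator sends the arc to the origin. The bound thus holds for every real s,
    as [measurable_potential] demands. *)
Lemma arc_le1 (sg tau s : R) : (sg ^+ 2 = 1)%R -> (1 <= tau)%R ->
  (arc_re sg tau s ^+ 2 + arc_im sg tau s ^+ 2 <= 1)%R.
Proof.
move=> sg1 tau1; rewrite /arc_re /arc_im indicE.
case: (boolP (s \in _)) => [|_]; last by rewrite !mulr0 expr0n/= addr0.
rewrite inE/= in_itv/= => /andP[s0 s1].
have tau0 : (0 < tau)%R by exact: lt_le_trans tau1.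
rewrite !mulr1 !exprMn -mulrDr cos2Dsin2 sg1 mul1r mulr1.
have := sqr_sin_le (s / tau) (divr_ge0 (ltW s0) (ltW tau0)).
rewrite expr_div_n => h.
have := ler_wpM2l (sqr_ge0 tau) h.
have -> : (tau ^+ 2 * (s ^+ 2 / tau ^+ 2) = s ^+ 2)%R by field; rewrite gt_eqF.
by move=> h'; apply: le_trans h' _; nra.
Qed.

Lemma arc_neg_ge0 sg tau s : 0 <= arc_neg sg tau s.
Proof. by rewrite le_max lexx orbT. Qed.

Lemma measurable_arc_neg sg tau : (sg ^+ 2 = 1)%R -> (1 <= tau)%R ->
  measurable_fun setT (arc_neg sg tau).
Proof.
move=> sg1 tau1.
have mind : measurable_fun setT (\1_D : R -> R).
  by apply: measurable_indic; exact: measurable_itv.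
have mdiv : measurable_fun setT (fun s : R => s / tau)%R by exact: measurable_funM.
have msin : measurable_fun setT (fun s : R => sin (s / tau)).
  apply: (measurableT_comp _ mdiv); apply: continuous_measurable_fun.
  exact: continuous_sin.
have mcos : measurable_fun setT (fun s : R => cos (s / tau)).
  apply: (measurableT_comp _ mdiv); apply: continuous_measurable_fun.
  exact: continuous_cos.
have mp := measurable_potential mu xi eta mxi meta Wfin.
apply: measurable_maxe => //; apply: measurableT_comp => //.
apply: mp => [| |s]; last exact: arc_le1.
- by do 2! apply: measurable_funM => //; do 2! apply: measurable_funM => //.
- by do 2! apply: measurable_funM => //; do 2! apply: measurable_funM => //.
Qed.

(** Radii tau_n >= n + 1 are chosen with arc integrals below 1/(n + 1). The negative part at sg s is
    at most the lower limit of its values on these arcs, so its integral is 0. *)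
Lemma potential_ge0_ae (sg : R) : (sg ^+ 2 = 1)%R ->
  (forall e Y : R, (0 < e)%R -> exists tau : R, [/\ (1 <= tau)%R, (Y <= tau)%R &
     \int[mu1]_(s in `]0%R, 1%R]) arc_neg sg tau s < e%:E]) ->
  {ae mu1, forall s, `]0%R, 1%R]%classic s -> 0 <= pot (sg * s) 0}.
Proof.
move=> sg1 small.
have /choice[tau tauP] : forall n : nat, exists tau : R, [/\ (1 <= tau)%R, (n.+1%:R <= tau)%R &
     \int[mu1]_(s in D) arc_neg sg tau s < (n.+1%:R^-1)%:E].
  by move=> n; apply: small; rewrite invr_gt0.
have tau1 n : (1 <= tau n)%R by have [] := tauP n.
have tau0 n : (0 < tau n)%R by exact: lt_le_trans (tau1 n).
have mD : measurable D by exact: measurable_itv.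
pose f (s : R) : \bar R := maxe (- pot (sg * s * \1_D s)%R 0%R) 0.
have clip (s : R) : ((sg * s * \1_D s) ^+ 2 + 0 ^+ 2 <= 1)%R.
  rewrite indicE; case: (boolP (s \in D)) => [|_]; last by rewrite mulr0 expr0n/= addr0.
  rewrite inE /D/= in_itv/= => /andP[s0 s1]; rewrite mulr1 exprMn sg1 mul1r expr0n/= addr0; nra.
have mf : measurable_fun setT f.
  apply: measurable_maxe => //; apply: measurableT_comp => //.
  apply: (measurable_potential mu xi eta mxi meta Wfin) => // .
  apply: measurable_funM; first exact: measurable_funM.
  exact: measurable_indic.
have f0 s : 0 <= f s by rewrite le_max lexx orbT.
have fle s : D s -> f s <= limn_einf (fun n => arc_neg sg (tau n) s).
  move=> Ds; have [s0 s1] : (0 < s)%R /\ (s <= 1)%R.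
    by move: Ds; rewrite /D/= in_itv/= => /andP.
  apply: limn_einf_ge => c.
  have [c0 _|c0] := ltP c 0%R.
    by near=> n; apply: le_trans (arc_neg_ge0 _ _ _); rewrite lee_fin ltW.
  rewrite /f indicE mem_set// mulr1 lt_max => /orP[|]; last by rewrite lte_fin ltNge c0.
  rewrite lteNr -EFinN => hc.
  have q0 : (s / tau n)%R @[n --> \oo] --> (0%R : R).
    have c1 : (s * harmonic n)%R @[n --> \oo] --> (s * 0)%R by apply: cvgMr; exact: cvg_harmonic.
    rewrite mulr0 in c1.
    apply: (squeeze_cvgr _ (cvg_cst 0%R) c1); near=> n.
    rewrite (divr_ge0 (ltW s0) (ltW (tau0 n)))/= ler_pM2l// lef_pV2 ?posrE//.
    by have [] := tauP n.
  (* The mean value form tau sin(s / tau) = s cos z, with 0 <= z <= s / tau, makes the limit s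
     visible. *)
  have /choice[z zP] : forall n, exists z : R, (0 <= z <= s / tau n)%R /\
      sin (s / tau n) = (s / tau n * cos z)%R.
    move=> n; have [|z h1 h2] := sin_mean_value (s / tau n)%R; last by exists z.
    exact: divr_ge0 (ltW s0) (ltW (tau0 n)).
  have z0 : z n @[n --> \oo] --> (0%R : R).
    apply: (squeeze_cvgr _ (cvg_cst 0%R) q0); near=> n; by have [] := zP n.
  have cz : cos (z n) @[n --> \oo] --> (1%R : R).
    rewrite -(@cos0 R); apply: (continuous_cvg _ _ z0); exact: continuous_cos.
  have cq : cos (s / tau n) @[n --> \oo] --> (1%R : R).
    rewrite -(@cos0 R); apply: (continuous_cvg _ _ q0); exact: continuous_cos.
  have sq : sin (s / tau n) @[n --> \oo] --> (0%R : R).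
    rewrite -(@sin0 R); apply: (continuous_cvg _ _ q0); exact: continuous_sin.
  have reE n : arc_re sg (tau n) s = (sg * s * cos (z n) * cos (s / tau n))%R.
    rewrite /arc_re indicE mem_set// mulr1; have [_ ->] := zP n.
    by field; rewrite gt_eqF.
  have imE n : arc_im sg (tau n) s = (sg * s * cos (z n) * sin (s / tau n))%R.
    rewrite /arc_im indicE mem_set// mulr1; have [_ {1}->] := zP n.
    by field; rewrite gt_eqF.
  have cre : arc_re sg (tau n) s @[n --> \oo] --> (sg * s)%R.
    rewrite (_ : (fun n => _) = (fun n => sg * s * cos (z n) * cos (s / tau n))%R); last exact/funext.
    have h : (sg * s * cos (z n) * cos (s / tau n))%R @[n --> \oo] --> (sg * s * 1 * 1)%R.
      by apply: cvgM => //; apply: cvgMr.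
    by rewrite !mulr1 in h.
  have cim : arc_im sg (tau n) s @[n --> \oo] --> (0%R : R).
    rewrite (_ : (fun n => _) = (fun n => sg * s * cos (z n) * sin (s / tau n))%R); last exact/funext.
    have h : (sg * s * cos (z n) * sin (s / tau n))%R @[n --> \oo] --> (sg * s * 1 * 0)%R.
      by apply: cvgM => //; apply: cvgMr.
    by rewrite mulr0 in h.
  have clip' : ((sg * s) ^+ 2 + 0 ^+ 2 <= 1)%R.
    by have := clip s; rewrite indicE mem_set// mulr1.
  have := potential_usc mu xi eta mxi meta Wfin _ _ _ _ _ cre cim
    (fun n => arc_le1 sg (tau n) s sg1 (tau1 n)) clip' hc.
  by apply: filterS => n hn; rewrite /arc_neg le_max leeNr -EFinN hn.
have intf : \int[mu1]_(s in D) f s <= 0.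
  have := @fatou _ _ _ mu1 D mD (fun n => arc_neg sg (tau n)) _ _.
  move=> F; apply: (@le_trans _ _ (\int[mu1]_(s in D) limn_einf (fun n => arc_neg sg (tau n) s))).
    exact: le_integral_pointwise.
  apply: le_trans (F _ _) _.
  - by move=> n; apply: measurable_funTS; exact: measurable_arc_neg.
  - by move=> n s _; exact: arc_neg_ge0.
  rewrite leNgt; apply/negP => pos.
  have [e e0 /limn_einf_gt eX] : exists2 e : R, (0 < e)%R &
      e%:E < limn_einf (fun n => \int[mu1]_(s in D) arc_neg sg (tau n) s).
    move: pos; case: (limn_einf _) => [x| |]//.
      by rewrite lte_fin => x0; exists (x / 2)%R; rewrite ?lte_fin; lra.
    by exists 1%R; rewrite // ltry.
  have hs : \forall n \near \oo, (n.+1%:R^-1 < e)%R.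
    exact: (near_infty_natSinv_lt (PosNum e0)).
  have [n [h1 h2]] := filter_ex (filterI eX hs).
  have [_ _ h3] := tauP n.
  have := lt_trans (le_lt_trans h1 h3) (_ : (n.+1%:R^-1)%:E < e%:E).
  by rewrite ltxx lte_fin h2 => /(_ isT).
have : \int[mu1]_(s in D) `|f s| = 0.
  apply/eqP; rewrite eq_le; apply/andP; split; last exact: integral_ge0.
  suff -> : \int[mu1]_(s in D) `|f s| = \int[mu1]_(s in D) f s by [].
  by apply: eq_integral => s _; rewrite gee0_abs.
move=> /(ae_eq_integral_abs mu1 mD (measurable_funTS mf))[N [mN N0 Nsub]].
exists N; split => // s nP; apply: Nsub => /= h; apply: nP => /= Ds.
have := h Ds; rewrite /f indicE mem_set// mulr1 => /eqP.
rewrite /cst eq_le ge_max => /andP[/andP[+ _] _].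
by rewrite leeNl oppe0.
Unshelve. all: by end_near. Qed.

(** If the arc integrals stayed above e for all large tau, then m t would be at least a constant
    times t, and the integral of m t / t^2 would dominate a divergent integral of 1/t. *)
Lemma arc_neg_small (sg r : R) (m : R -> \bar R) : (0 < r)%R ->
  (forall t, 0 <= m t) ->
  (forall t, (r <= t)%R ->
     ((2 * pi)^-1 * (t / r))%:E * \int[mu1]_(s in `]0%R, 1%R]) arc_neg sg (t / r) s <= m t) ->
  \int[mu1]_(t in `[r, +oo[) (m t * ((t ^+ 2)^-1)%:E) < +oo ->
  forall e Y : R, (0 < e)%R -> exists tau : R, [/\ (1 <= tau)%R, (Y <= tau)%R &
     \int[mu1]_(s in `]0%R, 1%R]) arc_neg sg tau s < e%:E].
Proof.
move=> r0 m0 hm mfin e Y e0; apply: contrapT => none.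
pose Z : R := Num.max 1%R Y.
have big (tau : R) : (Z <= tau)%R -> e%:E <= \int[mu1]_(s in `]0%R, 1%R]) arc_neg sg tau s.
  rewrite ge_max => /andP[t1 tY]; rewrite leNgt; apply/negP => h.
  by apply: none; exists tau.
have Z1 : (1 <= Z)%R by rewrite le_max lexx.
have pi0 : (0 < pi :> R)%R by exact: pi_gt0.
pose k : R := ((2 * pi)^-1 * e / r)%R.
have k0 : (0 < k)%R by rewrite divr_gt0 ?mulr_gt0 ?invr_gt0 ?mulr_gt0.
have rZ0 : (0 < r * Z)%R by rewrite mulr_gt0//; exact: lt_le_trans Z1.
have low (X : R) : (r * Z < X)%R -> (k * (ln X - ln (r * Z)))%:E <=
    \int[mu1]_(t in `[r, +oo[) (m t * ((t ^+ 2)^-1)%:E).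
  move=> ZX.
  have pos (t : R) : (r * Z <= t <= X)%R -> (0 < t)%R by move=> /andP[h _]; exact: lt_le_trans h.
  have <- : \int[mu1]_(t in `[(r * Z)%R, X]) (k * t^-1)%:E = (k * (ln X - ln (r * Z)))%:E.
    have -> : (k * (ln X - ln (r * Z)) = k * ln X - k * ln (r * Z))%R by ring.
    apply: (@FTC2_is_derive R (fun t => k * t^-1)%R (fun t => k * (- t ^- 2))%R (fun t => k * ln t)%R _ _ ZX) => t /pos t0.
      have t0' : (t != 0)%R by rewrite gt_eqF.
      exact: (is_deriveZ k (is_derive_inv t t0')).
    exact: (is_deriveZ k (is_derive1_ln t0)).
  rewrite [leLHS]integral_indic_mul [leRHS]integral_indic_mul.
  apply: le_integral_pointwise => t _.
  rewrite !indicE; case: (boolP (t \in `[(r * Z)%R, X]%classic)) => [|_]; last first.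
    rewrite mule0 mule_ge0//; by rewrite mule_ge0// lee_fin invr_ge0 sqr_ge0.
  rewrite inE/= in_itv/= => tZX; have t0 := pos _ tZX; have /andP[Zt _] := tZX.
  have rt : (r <= t)%R by apply: le_trans Zt; rewrite ler_peMr// ltW.
  rewrite mem_set; last by rewrite /= in_itv/= rt.
  rewrite !mule1.
  have tr : (Z <= t / r)%R by rewrite ler_pdivlMr// mulrC.
  have c0 : (0 <= (2 * pi)^-1 * (t / r))%R.
    have p2 : (0 < (2 * pi)^-1 :> R)%R by rewrite invr_gt0 mulr_gt0.
    exact: mulr_ge0 (ltW p2) (ltW (divr_gt0 t0 r0)).
  have h := le_trans (lee_wpmul2l (_ : 0 <= ((2 * pi)^-1 * (t / r))%:E) (big _ tr)) (hm t rt).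
  have i0 : 0 <= ((t ^+ 2)^-1)%:E :> \bar R by rewrite lee_fin invr_ge0 sqr_ge0.
  apply: le_trans (lee_wpmul2r i0 (h _)); last by rewrite lee_fin.
  rewrite -!EFinM lee_fin le_eqVlt; apply/orP; left; apply/eqP.
  rewrite /k; move: ((2 * pi)^-1)%R => q.
  by field; rewrite !gt_eqF.
have I0 : 0 <= \int[mu1]_(t in `[r, +oo[) (m t * ((t ^+ 2)^-1)%:E).
  by apply: integral_ge0 => t _; rewrite mule_ge0// lee_fin invr_ge0 sqr_ge0.
move: mfin low I0; case: (\int[mu1]_(t in `[r, +oo[) _) => [I| |]// _ low I0.
(* Chosen so that the lower bound k (ln X - ln (r Z)) equals I + 1. *)
pose X : R := (r * Z * expR ((I + 1) / k))%R.
have ik : (0 < (I + 1) / k)%R by rewrite divr_gt0//; move: I0; rewrite lee_fin; lra.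
have := low X; rewrite /X ltr_pMr// expR_gt1 ik => /(_ isT).
rewrite lnM ?posrE ?expR_gt0// expRK lee_fin.
have -> : (k * (ln (r * Z) + (I + 1) / k - ln (r * Z)) = I + 1)%R by field; rewrite gt_eqF.
by lra.
Qed.

End boundary_values.

(** * Complex coordinates *)

Section complex_coordinates.
Context {R : realType}.
Import Normc.
Local Open Scope complex_scope.

(** A 1-Lipschitz function pulls open half-lines back to sets open for the modulus, and these
    generate the sigma-algebra of [borelC]. *)
Lemma measurable_of_lip (f : R[i] -> R) :
  (forall x y : R[i], `|f x - f y|%R <= normc (x - y))%R ->
  measurable_fun setT (f : borelC R -> R).
Proof.
move=> fl; apply: (measurability _ (RGenOInfty.measurableE R)).
move=> /= _ [_ [a ->]] <-; apply: measurableI => //.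
apply: sub_sigma_algebra => /=.
rewrite openE => z /=; rewrite in_itv/= andbT => az.
apply/nbhs_ballP => /=.
exists ((f z - a)%:C)%R => /=; first by rewrite ltcR subr_gt0.
move=> y; rewrite /ball/= => zy; rewrite in_itv/= andbT.
have : (normc (z - y) < f z - a)%R by move: zy; rewrite -ltcR.
by have := fl z y; rewrite ler_norml => /andP[_ h1] h2; lra.
Qed.

Lemma ReB_le_normc (x y : R[i]) : (`|complex.Re x - complex.Re y| <= normc (x - y))%R.
Proof.
case: x y => [a b] [c e] /=; rewrite -sqrtr_sqr ler_wsqrtr//.
by rewrite lerDl sqr_ge0.
Qed.

Lemma ImB_le_normc (x y : R[i]) : (`|complex.Im x - complex.Im y| <= normc (x - y))%R.
Proof.
case: x y => [a b] [c e] /=; rewrite -sqrtr_sqr ler_wsqrtr//.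
by rewrite lerDr sqr_ge0.
Qed.

(** The coordinates of r / zeta; both are 0 at zeta = 0, by the convention 0^-1 = 0. *)
Definition inv_re (r : R) (z : borelC R) : R := (r * complex.Re ((z : R[i])^-1)%R)%R.
Definition inv_im (r : R) (z : borelC R) : R := (r * complex.Im ((z : R[i])^-1)%R)%R.

Lemma measurable_inv_coordinates (r : R) :
  measurable_fun setT (inv_re r) /\ measurable_fun setT (inv_im r).
Proof.
have mRe := measurable_of_lip _ ReB_le_normc.
have mIm := measurable_of_lip _ ImB_le_normc.
have minv : measurable_fun setT (fun z : borelC R =>
    (complex.Re (z : R[i]) ^+ 2 + complex.Im (z : R[i]) ^+ 2) `^ (-1))%R.
  apply: (measurableT_comp (measurable_powR (-1)%R)).
  by apply: measurable_funD; exact: measurable_funX.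
have reE : inv_re r = (fun z : borelC R => r * (complex.Re (z : R[i]) *
    (complex.Re (z : R[i]) ^+ 2 + complex.Im (z : R[i]) ^+ 2) `^ (-1)))%R.
  apply/funext => z; rewrite /inv_re powR_inv1; last by rewrite addr_ge0 ?sqr_ge0.
  by case: z.
have imE : inv_im r = (fun z : borelC R => r * (- complex.Im (z : R[i]) *
    (complex.Re (z : R[i]) ^+ 2 + complex.Im (z : R[i]) ^+ 2) `^ (-1)))%R.
  apply/funext => z; rewrite /inv_im powR_inv1; last by rewrite addr_ge0 ?sqr_ge0.
  by case: z => a b; rewrite /= mulNr.
rewrite reE imE; split; apply: measurable_funM => //; apply: measurable_funM => //.
exact: measurableT_comp.
Qed.

Lemma genus1_kernelE (r : R) (z : R[i]) (zeta : borelC R) : (0 < r)%R ->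
  genus1_kernel (z / (zeta : R[i]))%R =
  hker (complex.Re z / r) (complex.Im z / r) (inv_re r zeta) (inv_im r zeta).
Proof.
move=> r0; rewrite /genus1_kernel /inv_re /inv_im.
set w := ((zeta : R[i])^-1)%R; clearbody w.
case: z w => [x y] [p q]; rewrite /hker /dist2 /=.
have -> : (x / r * (r * p) - y / r * (r * q) = x * p - y * q)%R by field; rewrite gt_eqF.
have -> : (x / r * (r * q) + y / r * (r * p) = x * q + y * p)%R by field; rewrite gt_eqF.
set A := ((1 - (x * p - y * q)) ^+ 2)%R.
have -> : ((0 - (x * q + y * p)) ^+ 2 = (x * q + y * p) ^+ 2)%R by rewrite sub0r sqrrN.
set B := ((x * q + y * p) ^+ 2)%R.
have AB0 : (0 <= A + B)%R by rewrite addr_ge0 ?sqr_ge0.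
have [/eqP AB|AB] := boolP (A + B == 0)%R.
  by rewrite AB sqrtr0 lexx addNye.
have {}AB : (0 < A + B)%R by rewrite lt_def AB.
rewrite leNgt sqrtr_gt0 AB/=.
have -> : ln (A + B) = (2 * ln (Num.sqrt (A + B)))%R.
  by rewrite -ln_sqr ?sqrtr_gt0// sqr_sqrtr.
by rewrite -EFinD; congr EFin; field.
Qed.

Lemma rho2_inv (r : R) (zeta : borelC R) :
  rho2 (inv_re r zeta) (inv_im r zeta) = ((r / normc (zeta : R[i])) ^+ 2)%R.
Proof.
rewrite -normcV /rho2 /inv_re /inv_im; case: ((zeta : R[i])^-1)%R => p q /=.
by rewrite [RHS]exprMn sqr_sqrtr ?addr_ge0 ?sqr_ge0//; ring.
Qed.

Lemma normc_ge0 (z : R[i]) : (0 <= normc z)%R.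
Proof. by case: z => a b; exact: sqrtr_ge0. Qed.

(** Carries [genus1_integrable] over to every radius. The factor depends on r, but it serves only
    for finiteness and never enters K. At zeta = 0 the right-hand side is +oo. *)
Lemma weight_inv_le (r : R) (zeta : borelC R) : (0 < r)%R ->
  ((Num.max r (r ^+ 2))^-1 * weight (inv_re r zeta) (inv_im r zeta))%:E <=
  mine ((normc (zeta : R[i]))%:E^-1) ((normc (zeta : R[i]) ^+ 2)%:E^-1).
Proof.
move=> r0; have n0 := normc_ge0 (zeta : R[i]).
rewrite /weight rho2_inv sqrtr_sqr ger0_norm ?divr_ge0 ?(ltW r0)//.
set n := normc _ in n0 *.
have C0 : (0 < Num.max r (r ^+ 2))%R by rewrite lt_max r0.
have [->|nn] := eqVneq n 0%R.
  by rewrite expr0n/= !inve0 minxx leey.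
have np : (0 < n)%R by rewrite lt_def nn.
rewrite !inver !(gt_eqF _) ?exprn_gt0// -EFin_min lee_fin.
rewrite mulrC ler_pdivrMr// minr_pMl ?(ltW C0)// le_min !ge_min; apply/andP; split.
  by apply/orP; left; rewrite mulrC ler_wpM2l ?invr_ge0// le_max lexx.
by apply/orP; right; rewrite expr_div_n mulrC ler_wpM2l ?invr_ge0 ?sqr_ge0// le_max lexx orbT.
Qed.

(** Tonelli's theorem requires sigma-finiteness. By Chebyshev's inequality the sets where w is at
    least 1/(k + 1) have finite measure. The zero set of w may be added to each of them, since the
    integrand is +oo there. *)
Lemma genus1_sigma_finite (mu : {measure set (borelC R) -> \bar R}) :
  genus1_integrable mu -> sigma_finite setT mu.
Proof.
move=> gi.
have [m1 m2] := measurable_inv_coordinates 1.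
pose w (z : borelC R) : R := weight (inv_re 1 z) (inv_im 1 z).
have mw : measurable_fun setT w by exact: measurable_weight.
have w0 z : (0 <= w z)%R by exact: weight_ge0.
have wle z : (w z)%:E <= mine ((normc (z : R[i]))%:E^-1) ((normc (z : R[i]) ^+ 2)%:E^-1).
  have := weight_inv_le 1 z ltr01.
  by rewrite expr1n maxxx invr1 mul1r.
have weq0 z : w z = 0%R -> normc (z : R[i]) = 0%R.
  rewrite /w /weight rho2_inv sqrtr_sqr => wz; apply/eqP; apply: contraT => nz.
  have np : (0 < normc (z : R[i]))%R by rewrite lt_def nz normc_ge0.
  have : (0 < Num.min `|1 / normc (z : R[i])| ((1 / normc (z : R[i])) ^+ 2))%R.
    by rewrite lt_min normr_gt0 gt_eqF ?divr_gt0// exprn_gt0// divr_gt0.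
  by rewrite wz ltxx.
pose F (k : nat) : set (borelC R) :=
  [set z | (k.+1%:R^-1 <= w z)%R] `|` [set z | w z = 0%R].
exists F.
  apply/esym/seteqP; split => // z _.
  have [wz|wz] := eqVneq (w z) 0%R; first by exists 0%N => //; right.
  have wp : (0 < w z)%R by rewrite lt_def wz w0.
  have [k hk] := filter_ex (near_infty_natSinv_lt (PosNum wp)).
  by exists k => //; left; exact: ltW.
move=> k.
have mF : measurable (F k).
  apply: measurableU.
    rewrite -[X in measurable X]setTI (_ : [set z | _] = (fun z => (k.+1%:R^-1 <= w z)%R) @^-1` [set true]).
      exact: measurable_fun_ler.
    by apply/seteqP; split.
  rewrite -[X in measurable X]setTI (_ : [set z | _] = w @^-1` [set 0%R]) //.
  by apply: mw => //; exact: measurable_set1.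
split => //.
have kp : (0 < k.+1%:R^-1 :> R)%R by rewrite invr_gt0.
have key : (k.+1%:R^-1)%:E * mu (F k) < +oo.
  apply: le_lt_trans gi.
  have -> : (k.+1%:R^-1)%:E * mu (F k) = \int[mu]_z ((k.+1%:R^-1)%:E * (\1_(F k) z)%:E).
    by rewrite -integral_indic_mul integral_cst.
  apply: le_integral_pointwise => z _; rewrite indicE.
  case: (boolP (z \in F k)) => [|_]; last first.
    rewrite mule0 le_min; apply/andP; split; rewrite inve_ge0 lee_fin ?sqr_ge0//; exact: normc_ge0.
  rewrite inE mule1 => -[/= h|/weq0 ->]; first by apply: le_trans (wle z); rewrite lee_fin.
  by rewrite expr0n/= !inve0 minxx leey.
move: key; case: (mu (F k)) => [x _| |_]; rewrite ?ltry ?ltNyr//.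
by rewrite gt0_muley ?lte_fin// ltxx.
Qed.

End complex_coordinates.

(** * The Tsuji functionals in the coordinates of r / zeta *)

Section tsuji.
Context {R : realType}.
Import Normc.
Local Open Scope complex_scope.
Variables (mu : {sigma_finite_measure set (borelC R) -> \bar R}) (r : R).
Hypothesis r0 : (0 < r)%R.
Hypothesis Wfin : \int[mu]_t (weight (inv_re r t) (inv_im r t))%:E < +oo.
Local Notation mu1 := (@lebesgue_measure R).

Lemma canonical_integralE (z : R[i]) : canonical_integral mu z =
  potential mu (inv_re r) (inv_im r) (complex.Re z / r) (complex.Im z / r).
Proof. by apply: eq_integral => zeta _; exact: genus1_kernelE. Qed.

Lemma levin_tsuji_countingE (t : R) : (0 < t)%R ->
  levin_tsuji_counting mu t = mu [set z | r <= t * `|inv_im r z|]%R.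
Proof.
move=> t0; congr (mu _); apply/seteqP; split => z /=; rewrite /inv_im normrM gtr0_norm//.
  move=> h; rewrite mulrCA ler_peMr ?(ltW r0)// -(ler_pM2l (_ : 0 < t^-1)%R) ?invr_gt0//.
  by rewrite mulr1 mulrA mulVf ?mul1r// gt_eqF.
rewrite mulrCA -[X in (X <= _)%R -> _]mulr1 ler_pM2l// => h.
by rewrite -[t^-1%R]mulr1 ler_pdivrMl.
Qed.

Lemma tsuji_proximity_ge0 (t : R) : 0 <= tsuji_proximity (canonical_integral mu) t.
Proof.
rewrite mule_ge0 ?lee_fin ?invr_ge0 ?mulr_ge0 ?pi_ge0//; apply: integral_ge0 => x _.
by rewrite mule_ge0// lee_fin invr_ge0 sqr_ge0.
Qed.

(** Only the angles theta in (b, b + 1/tau] are kept, with s = tau (theta - b). There 1/sin^2 theta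
    is at least tau^2, because |sin theta| <= theta - b <= 1/tau, and the change of variable costs
    1/tau; the net factor is tau = t / r. *)
Lemma tsuji_proximity_ge (sg t : R) : sg = 1%R \/ sg = (-1)%R -> (r <= t)%R ->
  ((2 * pi)^-1 * (t / r))%:E *
    \int[mu1]_(s in `]0%R, 1%R]) arc_neg mu (inv_re r) (inv_im r) sg (t / r) s <=
  tsuji_proximity (canonical_integral mu) t.
Proof.
move=> sgP rt.
have t0 : (0 < t)%R by exact: lt_le_trans rt.
set tau := (t / r)%R.
have tau1 : (1 <= tau)%R by rewrite ler_pdivlMr// mul1r.
have tau0 : (0 < tau)%R by exact: lt_le_trans tau1.
have pi0 : (0 < pi :> R)%R by exact: pi_gt0.
have pi2 : (2 <= pi :> R)%R by exact: pi_ge2.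
have sg2 : (sg ^+ 2 = 1)%R by case: sgP => ->; rewrite ?sqrrN expr1n.
(* A shift by pi changes the sign of both sine and cosine, so angles just above pi give points close
   to the negative axis. *)
have [b [b0 bpi sinb cosb]] : exists b : R, [/\ (0 <= b)%R, (b <= pi)%R,
    (forall x, sin (b + x) = sg * sin x)%R & (forall x, cos (b + x) = sg * cos x)%R].
  case: sgP => ->.
    by exists 0%R; split => //; [exact: ltW|move=> x; rewrite add0r mul1r|move=> x; rewrite add0r mul1r].
  by exists pi; split => //; [exact: ltW|move=> x; rewrite addrC sinDpi mulN1r|move=> x; rewrite addrC cosDpi mulN1r].
have c0 : (0 < tau^-1)%R by rewrite invr_gt0.
have c1 : (tau^-1 <= 1)%R by rewrite invf_le1.
have [m1 m2] := measurable_inv_coordinates r.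
pose h (s : R) : \bar R := (tau ^+ 2)%:E * arc_neg mu (inv_re r) (inv_im r) sg tau s.
have mh : measurable_fun setT (arc_neg mu (inv_re r) (inv_im r) sg tau).
  exact: measurable_arc_neg.
have an0 s := arc_neg_ge0 mu (inv_re r) (inv_im r) sg tau s.
have h0 s : 0 <= h s by rewrite mule_ge0// lee_fin sqr_ge0.
have hI : \int[mu1]_(x in `]b, (b + tau^-1)%R]) h ((x - b) / tau^-1)%R =
    tau%:E * \int[mu1]_(s in `]0%R, 1%R]) arc_neg mu (inv_re r) (inv_im r) sg tau s.
  rewrite ge0_integral_affine//; last exact: emeasurable_funM.
  rewrite ge0_integralZl_EFin ?sqr_ge0//; last exact: measurable_funTS.
  rewrite muleA -EFinM; congr (_%:E * _).
  by field; rewrite gt_eqF.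
rewrite EFinM -muleA -hI /tsuji_proximity lee_wpmul2l ?lee_fin ?invr_ge0 ?mulr_ge0 ?pi_ge0//.
rewrite [leLHS]integral_indic_mul [leRHS]integral_indic_mul.
apply: le_integral_pointwise => x _; rewrite !indicE.
case: (boolP (x \in `]b, (b + tau^-1)%R]%classic)) => [|_]; last first.
  rewrite mule0 mule_ge0//; first by rewrite mule_ge0// lee_fin invr_ge0 sqr_ge0.
rewrite inE/= in_itv/= => /andP[bx xb].
rewrite mem_set; last by rewrite /= in_itv/=; lra.
rewrite !mule1 invrK /h.
set p := (x - b)%R.
have p0 : (0 < p)%R by rewrite /p; lra.
have pt : (p <= tau^-1)%R by rewrite /p; lra.
have xE : x = (b + p)%R by rewrite /p; ring.
have sp : (0 < sin p)%R by apply: sin_gt0_pi; lra.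
have ptE : (p * tau / tau = p)%R by rewrite mulfK// gt_eqF.
have s01 : (p * tau)%R \in (`]0%R, 1%R]%classic : set R).
  by rewrite inE/= in_itv/= mulr_gt0// -ler_pdivlMr// mul1r.
rewrite muleC; apply: lee_pmul => //.
- rewrite lee_fin sqr_ge0//.
- rewrite funenegE /arc_neg canonical_integralE /arc_re /arc_im indicE s01 !mulr1 ptE.
  rewrite xE sinb cosb/=.
  have -> : (`|sg * sin p| = sin p)%R.
    rewrite normrM (gtr0_norm sp); case: sgP => ->; by rewrite ?normrN normr1 mul1r.
  rewrite !mul0r subr0 addr0.
  have -> : (t * sin p * (sg * cos p) / r = sg * (tau * sin p) * cos p)%R by rewrite /tau; field; rewrite gt_eqF.
  have -> : (t * sin p * (sg * sin p) / r = sg * (tau * sin p) * sin p)%R by rewrite /tau; field; rewrite gt_eqF.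
  by [].
- rewrite lee_fin xE sinb (exprMn _ sg) sg2 mul1r.
  rewrite -[leLHS]invrK lef_pV2 ?posrE ?invr_gt0 ?exprn_gt0// -exprVn.
  apply: le_trans (sqr_sin_le _ (ltW p0)) _.
  by rewrite ler_pXn2r ?nnegrE ?(ltW p0) ?(ltW c0).
Qed.

End tsuji.

(** * The growth estimate *)

Section growth.
Context {d} {T : measurableType d} {R : realType}.
Variables (mu : {sigma_finite_measure set T -> \bar R}) (xi eta : T -> R).
Hypotheses (mxi : measurable_fun setT xi) (meta : measurable_fun setT eta).
Hypothesis Wfin : \int[mu]_t (weight (xi t) (eta t))%:E < +oo.
Local Notation mu1 := (@lebesgue_measure R).
Local Notation pot := (potential mu xi eta).

(** The interval [1/2, 1] has positive measure, so it contains a point s outside both exceptional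
    null sets; [potential_le] is applied at that s. *)
Lemma potential_le_vweight :
  (forall sg : R, sg = 1%R \/ sg = (-1)%R ->
    {ae mu1, forall s, `]0%R, 1%R]%classic s -> 0 <= pot (sg * s)%R 0%R}) ->
  forall a b : R, (a ^+ 2 + b ^+ 2 <= 1)%R ->
  pot a b <= 5%:E * (804%:E * \int[mu]_t (vweight (eta t))%:E) +
    \int[mu]_t (vweight (eta t))%:E.
Proof.
move=> pos a b ab.
have [N1 [mN1 N10 N1s]] := pos 1%R (or_introl erefl).
have [N2 [mN2 N20 N2s]] := pos (-1)%R (or_intror erefl).
have mN : measurable (N1 `|` N2) by exact: measurableU.
have N0 : mu1 (N1 `|` N2) = 0 by rewrite measureU0.
have good s : ~ (N1 `|` N2) s -> `]0%R, 1%R]%classic s -> 0 <= pot s 0%R /\ 0 <= pot (- s)%R 0%R.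
  move=> nN s01; split; rewrite leNgt; apply/negP => neg; apply: nN.
    by left; apply: N1s => /(_ s01); rewrite mul1r leNgt neg.
  by right; apply: N2s => /(_ s01); rewrite mulN1r leNgt neg.
have goodae : {ae mu1, forall s, `]0%R, 1%R]%classic s -> 0 <= pot s 0%R /\ 0 <= pot (- s)%R 0%R}.
  exists (N1 `|` N2); split => // s ns; apply: contrapT => nN.
  by apply: ns; exact: good.
have [s [sI sN]] : exists s : R, `[2^-1%R, 1%R]%classic s /\ ~ (N1 `|` N2) s.
  apply: contrapT => none.
  have sub : `[2^-1%R, 1%R]%classic `<=` N1 `|` N2.
    by move=> s sI; apply: contrapT => sN; apply: none; exists s.
  have : mu1 `[2^-1%R, 1%R]%classic <= 0.
    by rewrite -N0; apply: le_measure => //; rewrite inE.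
  rewrite lebesgue_measure_itv/= lte_fin ifT; last by rewrite invf_lt1 ?ltr1n.
  by rewrite -EFinB lee_fin; lra.
move: sI; rewrite /= in_itv/= => sI.
have s01 : `]0%R, 1%R]%classic s by rewrite /= in_itv/=; lra.
have [p1 p2] := good _ sN s01.
apply: le_trans (potential_le mu xi eta mxi meta Wfin a b s ab sI p1 p2) _.
have L := log_le_vweight mu xi eta mxi meta Wfin goodae.
by apply: leeD => //; apply: lee_wpmul2l => //; rewrite lee_fin.
Qed.

End growth.

(* [K] is hidden behind an existential because unification is apt to unfold large numerals. *)
Lemma lincomb_le {R : realType} (a b c : R) :
  (0 <= a)%R -> (0 <= b)%R -> (0 < c)%R ->
  exists2 K : R, (0 < K)%R & forall x y w : \bar R, 0 <= y -> 0 <= w -> x <= c%:E * y ->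
    a%:E * (b%:E * x) + x <= K%:E * (y + w).
Proof.
move=> a0 b0 cp; have c0 := ltW cp.
exists ((a * b + 1) * c)%R.
  by rewrite mulr_gt0// (lt_le_trans ltr01)// lerDr mulr_ge0.
move=> x y w y0 w0 xy.
have ab0 : (0 <= a * b)%R by exact: mulr_ge0.
have abc0 : (0 <= (a * b + 1) * c)%R by rewrite mulr_ge0// addr_ge0.
apply: (@le_trans _ _ (((a * b + 1) * c)%:E * y)); last first.
  by apply: lee_wpmul2l; rewrite ?lee_fin// leeDl.
rewrite EFinM -muleA EFinD ge0_muleDl ?lee_fin// mul1e EFinM -muleA.
by apply: leeD => //; apply: lee_wpmul2l; rewrite ?lee_fin//; apply: lee_wpmul2l; rewrite ?lee_fin.
Qed.

Lemma pmule_addy_pinfty {R : realType} (k q : R) (x : \bar R) :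
  (0 < k)%R -> (0 < q)%R -> 0 <= x -> k%:E * (x + q%:E * +oo) = +oo.
Proof.
move=> k0 q0 x0; rewrite (gt0_muley (x := q%:E)) ?lte_fin// addey ?gt0_muley ?lte_fin//.
by rewrite -ltNye (lt_le_trans _ x0)// ltNy0.
Qed.

Section sigma_finite_bundle.
Context {d} {T : measurableType d} {R : realType}.
Variables (mu : {measure set T -> \bar R}) (sf : sigma_finite setT mu).

(** An alias that takes the proof of sigma-finiteness as an argument, so that the bare measure of
    the theorem can receive the structure which the Tonelli arguments expect. *)
Definition with_sigma_finite of sigma_finite setT mu : set T -> \bar R := mu.

HB.instance Definition _ := Measure.copy (with_sigma_finite sf) mu.
HB.instance Definition _ := @Measure_isSigmaFinite.Build _ _ _ (with_sigma_finite sf) sf.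

End sigma_finite_bundle.

(** * Assembly of the estimate for the canonical integral *)

Section canonical_growth.
Context {R : realType}.
Import Normc.
Local Notation mu1 := (@lebesgue_measure R).

Lemma max_modulus_canonical_le : exists2 K : R, (0 < K)%R &
  forall (mu : {sigma_finite_measure set (borelC R) -> \bar R}) (r : R),
  genus1_integrable mu -> (0 < r)%R ->
  max_modulus (canonical_integral mu) r <=
    K%:E *
    (r%:E * \int[mu1]_(t in `]0%R, r]) (levin_tsuji_counting mu t * (t ^+ 2)^-1%:E)
     + (r ^+ 2)%:E * \int[mu1]_(t in `[r, +oo[) (levin_tsuji_counting mu t * (t ^+ 3)^-1%:E)
     + (r ^+ 2)%:E * \int[mu1]_(t in `[r, +oo[)
         (tsuji_proximity (canonical_integral mu) t * (t ^+ 2)^-1%:E)).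
Proof.
(* The constant is K = (5 * 804 + 1) * 16: 5 from [potential_le], 804 from [log_le_vweight], 16 from
   [counting_ge_vweight]. *)
have [K K0 lin] := @lincomb_le R 5%R 804%R 16%R (ler0n _ _) (ler0n _ _) (ltr0n _ _).
exists K => // mu r.
move=> gi r0; pose u := canonical_integral mu.
set n := levin_tsuji_counting mu; set m := tsuji_proximity u.
have [mxi meta] := measurable_inv_coordinates r.
have Wfin : \int[mu]_t (weight (inv_re r t) (inv_im r t))%:E < +oo.
  have C0 : (0 < (Num.max r (r ^+ 2))^-1)%R by rewrite invr_gt0 lt_max r0.
  have : ((Num.max r (r ^+ 2))^-1)%:E * \int[mu]_t (weight (inv_re r t) (inv_im r t))%:E < +oo.
    apply: le_lt_trans gi; rewrite -ge0_integralZl_EFin ?(ltW C0)//; last 2 first.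
    - by move=> t _; rewrite lee_fin weight_ge0.
    - by apply/measurable_EFinP; exact: measurable_weight.
    by apply: le_integral_pointwise => t _; exact: weight_inv_le.
  case: (\int[mu]_t _) => [x _| |_]; rewrite ?ltry ?ltNyr//.
  by rewrite gt0_muley ?lte_fin// ltxx.
have n0 t : 0 <= n t by exact: measure_ge0.
have m0 t : 0 <= m t by exact: tsuji_proximity_ge0.
have i0 k (t : R) : (0 < t)%R -> 0 <= ((t ^+ k)^-1)%:E :> \bar R.
  by move=> t0; rewrite lee_fin invr_ge0 exprn_ge0// ltW.
have A0 : 0 <= r%:E * \int[mu1]_(t in `]0%R, r]) (n t * (t ^+ 2)^-1%:E).
  rewrite mule_ge0 ?lee_fin ?(ltW r0)//; apply: integral_ge0 => t.
  by rewrite /= in_itv/= => /andP[t0 _]; rewrite mule_ge0 ?i0.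
have posr (t : R) : `[r, +oo[%classic t -> (0 < t)%R.
  by rewrite /= in_itv/= andbT; exact: lt_le_trans.
have B0 : 0 <= (r ^+ 2)%:E * \int[mu1]_(t in `[r, +oo[) (n t * (t ^+ 3)^-1%:E).
  rewrite mule_ge0 ?lee_fin ?sqr_ge0//; apply: integral_ge0 => t /posr t0.
  by rewrite mule_ge0 ?i0.
have C0 : 0 <= \int[mu1]_(t in `[r, +oo[) (m t * (t ^+ 2)^-1%:E).
  by apply: integral_ge0 => t /posr t0; rewrite mule_ge0 ?i0.
have AB0 := adde_ge0 A0 B0.
have [Cy|Cfin] := eqVneq (\int[mu1]_(t in `[r, +oo[) (m t * (t ^+ 2)^-1%:E)) +oo.
  by rewrite Cy pmule_addy_pinfty ?exprn_gt0 ?leey.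
have {}Cfin : \int[mu1]_(t in `[r, +oo[) (m t * (t ^+ 2)^-1%:E) < +oo by rewrite ltey.
have pos (sg : R) : sg = 1%R \/ sg = (-1)%R ->
    {ae mu1, forall s, `]0%R, 1%R]%classic s ->
      0 <= potential mu (inv_re r) (inv_im r) (sg * s)%R 0%R}.
  move=> sgP; have sg2 : (sg ^+ 2 = 1)%R by case: sgP => ->; rewrite ?sqrrN expr1n.
  apply: (potential_ge0_ae mu _ _ mxi meta Wfin) => //.
  apply: (arc_neg_small mu _ _ sg r m r0 m0 _ Cfin) => t rt.
  exact: tsuji_proximity_ge.
apply: ge_ereal_sup => _ [z /= zr <-].
have ab1 : ((complex.Re z / r) ^+ 2 + (complex.Im z / r) ^+ 2 <= 1)%R.
  rewrite !expr_div_n -mulrDl ler_pdivrMr ?exprn_gt0// mul1r.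
  rewrite -ler_sqrt ?sqr_ge0// sqrtr_sqr gtr0_norm//.
  by case: z zr.
rewrite /u (canonical_integralE mu r r0).
apply: le_trans (potential_le_vweight _ _ _ mxi meta Wfin pos _ _ ab1) _.
have V := counting_ge_vweight mu _ meta r r0.
have eqA : \int[mu1]_(t in `]0%R, r]) (mu [set x | (r <= t * `|inv_im r x|)%R] * ((t ^+ 2)^-1)%:E) =
    \int[mu1]_(t in `]0%R, r]) (n t * (t ^+ 2)^-1%:E).
  apply: eq_integral => t; rewrite inE/= in_itv/= => /andP[t0 _].
  by rewrite /n (levin_tsuji_countingE mu r r0).
have eqB : \int[mu1]_(t in `[r, +oo[) (mu [set x | (r <= t * `|inv_im r x|)%R] * ((t ^+ 3)^-1)%:E) =
    \int[mu1]_(t in `[r, +oo[) (n t * (t ^+ 3)^-1%:E).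
  apply: eq_integral => t; rewrite inE => /posr t0.
  by rewrite /n (levin_tsuji_countingE mu r r0).
rewrite eqA eqB in V.
by apply: lin => //; rewrite mule_ge0 ?lee_fin ?sqr_ge0.
Qed.

End canonical_growth.

Theorem theorem1 (R : realType) :
  exists2 K : R, (0 < K)%R &
  forall mu : {measure set (borelC R) -> \bar R},
    locally_finite mu -> genus1_integrable mu ->
  forall r : R, (0 < r)%R ->
    let u := canonical_integral mu in
    let n := levin_tsuji_counting mu in
    let m := tsuji_proximity u in
    max_modulus u r <=
      K%:E *
      (r%:E * \int[lebesgue_measure]_(t in `]0%R, r]) (n t * (t ^+ 2)^-1%:E)
       + (r ^+ 2)%:E *
         \int[lebesgue_measure]_(t in `[r, +oo[) (n t * (t ^+ 3)^-1%:E)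
       + (r ^+ 2)%:E *
         \int[lebesgue_measure]_(t in `[r, +oo[) (m t * (t ^+ 2)^-1%:E)).
Proof.
have [K K0 KP] := @max_modulus_canonical_le R; exists K => // mu _ gi r r0.
have sf := genus1_sigma_finite mu gi.
case: mu gi sf => mu cmu gi sf.
exact: (KP (with_sigma_finite _ sf) r gi r0).
Qed.
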